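(* Let $p$ be a prime number, $G$ a finite group and $K$ a field. Assume that the following four properties hold: (i) either $\operatorname{char}K=0$, or $\operatorname{char}K=l>0$ and $G$ contains no non-trivial normal $l$-subgroup; (ii) there is an element $\sigma\in Z(G)\subset G$ with $\operatorname{ord}(\sigma)=p$; (iii) there is a linear character $\chi:G\to K^{\times}$ with $\chi(\sigma)\neq 1$; (iv) for any $\tau\in Z(G)$, with $m=\operatorname{ord}(\tau)$, if $\langle\sigma\rangle$ is a proper subgroup of $\langle\tau\rangle$, then $\zeta_m\notin K$. Then $\operatorname{ed}_K(G)=\operatorname{ed}_K(G/\langle\sigma\rangle)+1$.
   Context: $Z(G)$ is the center of $G$ and $\operatorname{ord}(\tau)$ is the order of $\tau$. $\zeta_m$ denotes a primitive $m$-th root of unity; writing $\zeta_m\in K$ means that $K$ contains a primitive $m$-th root of unity and tacitly includes $\operatorname{char}K\nmid m$ (where $\operatorname{char}K\nmid m$ means $\operatorname{char}K=0$, or $\operatorname{char}K>0$ does not divide $m$). All fields are assumed to contain the ground field $K$. Let $L/L_0$ be a finite separable extension of fields containing $K$. For an intermediate field $K\subset E_0\subset L_0$, one says that $L/L_0$ is defined over $E_0$ if there is a field $E$ with $E_0\subset E\subset L$, $[E:E_0]=[L:L_0]$ and $L=EL_0$. The essential dimension $\operatorname{ed}_K(L/L_0)$ is the minimum of $\operatorname{trdeg}_K E_0$ (transcendence degree over $K$), where $E_0$ runs over all such fields over which $L/L_0$ is defined. For a finite group $G$, define $\operatorname{ed}_K(G)=\operatorname{ed}_K(K(V)/K(V)^G)$,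 where $G\to GL(V)$ is a faithful finite-dimensional representation over $K$, $K(V)=K(x_1,\ldots,x_n)$ is the rational function field in a basis $x_1,\ldots,x_n$ of the dual space of $V$ with the induced $G$-action, and $K(V)^G$ is the fixed field; this does not depend on the choice of the faithful representation. *)

(* Defs.v *)
From HB Require Import structures.
From mathcomp Require Import all_boot all_order all_algebra all_fingroup.
From mathcomp Require Import all_solvable all_field all_character.
From mathcomp Require Import mpoly.

Set Implicit Arguments.
Unset Strict Implicit.
Unset Printing Implicit Defensive.

Import GRing.Theory.
Local Open Scope ring_scope.

(* Subfields of a field are Prop-valued predicates rather than boolean ones,  *)
(* so that the quantifications over intermediate fields below range over all  *)
(* of them without an appeal to classical logic.                              *)

Definition subpred_of (L : Type) (A B : L -> Prop) : Prop :=
  forall x, A x -> B x.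

Section Subfields.
Variable L : fieldType.
Implicit Types (A E F S : L -> Prop) (x y : L) (d : nat).

(* Closure under inverses includes 0^-1 = 0, which is harmless. *)
Definition subfield S : Prop :=
  [/\ S 1, forall x y, S x -> S y -> S (x - y)
    & forall x y, S x -> S y -> S (x / y)].

Definition generated_field A x : Prop :=
  forall S, subfield S -> subpred_of A S -> S x.

Definition compositum E F : L -> Prop := generated_field (fun x => E x \/ F x).

(* [E : F] = d, witnessed by an F-basis b of E *)
Definition ext_degree F E d : Prop :=
  exists b : 'rV[L]_d, (forall i, E (b 0 i)) /\
    forall x, E x ->
      exists! c : 'rV[L]_d, (forall i, F (c 0 i)) /\
                            x = \sum_i c 0 i * b 0 i.

Definition algebraic_over F x : Prop :=
  exists p : {poly L}, [/\ p != 0, forall i, F p`_i & root p x].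

End Subfields.

Section EssentialDimension.
Variables (K L : fieldType) (iota : {rmorphism K -> L}).
Implicit Types (E : L -> Prop) (d : nat).

Definition ground_field (x : L) : Prop := exists a : K, x = iota a.

Definition alg_independent d (t : d.-tuple L) : Prop :=
  forall q : {mpoly K[d]}, mmap iota (tnth t) q = 0 -> q = 0.

(* trdeg_K E0 = d, witnessed by a transcendence basis t of E0 over K *)
Definition has_trdeg E0 d : Prop :=
  exists t : d.-tuple L,
    [/\ forall i, E0 (tnth t i),
        alg_independent t
      & forall x, E0 x ->
          algebraic_over
            (generated_field
               (fun y => ground_field y \/ exists i, y = tnth t i)) x].

(* L / L0 is defined over E0 *)
Definition defined_over (L0 E0 : L -> Prop) : Prop :=
  [/\ subfield E0, subpred_of ground_field E0, subpred_of E0 L0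
    & exists E : L -> Prop,
      [/\ subfield E, subpred_of E0 E,
          exists d, ext_degree E0 E d /\ ext_degree L0 (fun _ => True) d
        & forall x, compositum E L0 x]].

(* ed_K(L / L0) = d; fields E0 of infinite transcendence degree over K are    *)
(* irrelevant to the minimum.                                                 *)
Definition ed_ext_is (L0 : L -> Prop) d : Prop :=
  (exists E0, defined_over L0 E0 /\ has_trdeg E0 d) /\
  (forall E0 e, defined_over L0 E0 -> has_trdeg E0 e -> (d <= e)%N).

End EssentialDimension.

Lemma fraction_repr (R : idomainType) (f : {fraction R}) :
  f = FracField.tofrac \n_(generic_quotient.repr f) /
      FracField.tofrac \d_(generic_quotient.repr f).
Proof.
set r := generic_quotient.repr f.
have dF0 : FracField.tofrac \d_r != 0 by rewrite tofrac_eq0 denom_ratioP.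
apply: (mulIf dF0); rewrite divfK // -[f]generic_quotient.reprK -/r.
rewrite /FracField.tofrac; unlock.
rewrite -[LHS]FracField.pi_mul; apply/generic_quotient.eqmodP.
rewrite /= FracField.equivfE /FracField.mulf.
by rewrite !numden_Ratio ?mulf_neq0 ?oner_neq0 ?denom_ratioP // !mulr1 mulrC.
Qed.

Section RationalFunctions.
Variables (K : fieldType) (n : nat).

Definition ratfun : fieldType := {fraction {mpoly K[n]}}.

Definition ratfunC : {rmorphism K -> ratfun} :=
  (@FracField.tofrac {mpoly K[n]} : {rmorphism _ -> _}) \o @mpolyC n K.

Variables (gT : finGroupType) (G : {group gT}) (rG : mx_representation K G n).

(* V is the space of column vectors of size n, with g v = rG g *m v. The      *)
(* dual action is (g f)(v) = f (g^-1 v), which sends the coordinate function  *)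
(* x_i to \sum_j (rG g^-1)_(i, j) x_j.                                        *)
Definition poly_act (g : gT) (f : {mpoly K[n]}) : {mpoly K[n]} :=
  f \mPo [tuple \sum_(j < n) rG g^-1%g i j *: 'X_j | i < n].

(* For g \in G the result does not depend on the choice of the numerator and  *)
(* denominator: see ratfun_act_div.                                           *)
Definition ratfun_act (g : gT) (f : ratfun) : ratfun :=
  let r := generic_quotient.repr (f : {fraction {mpoly K[n]}}) in
  FracField.tofrac (poly_act g \n_r) / FracField.tofrac (poly_act g \d_r).

Definition ratfun_fixed (f : ratfun) : Prop :=
  forall g, g \in G -> ratfun_act g f = f.

Lemma poly_actK g : g \in G -> cancel (poly_act g) (poly_act g^-1%g).
Proof.
move=> Gg f; rewrite /poly_act.
set u := [tuple _ | i < n]; set t := [tuple _ | i < n].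
have tu i : tnth t i \mPo u = 'X_i.
  rewrite tnth_mktuple linear_sum /=.
  under eq_bigr => j _ do
    rewrite linearZ /= comp_mpolyXU -tnth_nth tnth_mktuple invgK scaler_sumr.
  rewrite exchange_big /=.
  under eq_bigr => k _.
    under eq_bigr => j _ do rewrite scalerA.
    rewrite -scaler_suml.
    have -> : \sum_j rG g^-1%g i j * rG g j k = (1%:M : 'M[K]_n) i k.
      by rewrite -(repr_mx1 rG) -(mulVg g) repr_mxM ?groupV // mxE.
    rewrite mxE; over.
  rewrite (bigD1 i) //= eqxx scale1r big1 ?addr0 // => k /negPf nki.
  by rewrite eq_sym nki scale0r.
rewrite [f \mPo t]comp_mpolyE (rmorph_sum (comp_mpoly u)) [RHS]mpolyE.
apply: eq_bigr => m _; rewrite /= comp_mpolyZ; congr (_ *: _).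
rewrite rmorph_prod /= [RHS]mpolyXE_id.
by apply: eq_bigr => i _; rewrite rmorphXn /= tu.
Qed.

Lemma ratfun_act_div g (a b : {mpoly K[n]}) : g \in G -> b != 0 ->
  ratfun_act g (FracField.tofrac a / FracField.tofrac b) =
  FracField.tofrac (poly_act g a) / FracField.tofrac (poly_act g b).
Proof.
move=> Gg nz_b; rewrite /ratfun_act.
have := fraction_repr (FracField.tofrac a / FracField.tofrac b).
move: (generic_quotient.repr _) => r /eqP.
have act_neq0 (h : {mpoly K[n]}) :
    h != 0 -> FracField.tofrac (poly_act g h) != 0.
  rewrite tofrac_eq0; apply: contra_neq => h0.
  by rewrite -(poly_actK Gg h) h0 /poly_act rmorph0.
rewrite eqr_div ?tofrac_eq0 ?denom_ratioP // => /eqP.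
rewrite -!tofracM => /eqP; rewrite tofrac_eq => /eqP eq_ab.
apply/eqP; rewrite eqr_div ?act_neq0 ?denom_ratioP //.
rewrite -!tofracM tofrac_eq /poly_act -!rmorphM /=.
by rewrite -eq_ab.
Qed.

End RationalFunctions.

(* ed_K(G) = d: ed_K(K(V) / K(V)^G) = d for every faithful representation V   *)
(* (there always is one, the regular representation).                         *)
Definition ed_group_is (K : fieldType) (gT : finGroupType) (G : {group gT})
    (d : nat) : Prop :=
  forall n (rG : mx_representation K G n), mx_faithful rG ->
    ed_ext_is (ratfunC K n) (ratfun_fixed rG) d.

(* Main.v *)
From HB Require Import structures.
Require Import Defs.
From mathcomp Require Import all_boot all_order all_algebra all_fingroup.
From mathcomp Require Import all_solvable all_field all_character.
From mathcomp Require Import mpoly.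
From Stdlib Require Import Classical ClassicalEpsilon.

Set Implicit Arguments.
Unset Strict Implicit.
Unset Printing Implicit Defensive.

Import GRing.Theory.
Local Open Scope ring_scope.

(** Essential dimension of G is an extremal problem about G-stable subfields.
    If E lies between K and K(V), is G-stable, and G acts faithfully on it, then
    K(V) / K(V)^G is defined over E^G, because by the independence of
    automorphisms one family of card(G) elements of E is a basis both of E over
    E^G and of K(V) over K(V)^G.  Conversely a field E over which the extension
    is defined generates, together with its G-conjugates, such a stable subfield
    without changing the transcendence degree.  So ed_K(G) is the least d for
    which the action on K(V) is [compressible] to transcendence degree d
    ([ed_ext_is_compressible]).

    Everything else is done with specializations: additive and multiplicative
    relations between two fields that behave like a place, of which the residue
    map of a localization of a polynomial ring is the example.  The residues of
    a G-stable subfield E form a G-stable subfield, and independent residues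
    lift to independent elements, so the transcendence degree does not grow
    ([residue_trdeg_le]); it drops if E contains a nonzero element of residue 0
    ([residue_trdeg_lt]).

    The choice of the faithful representation does not matter
    ([compressible_change_rep]): a generic equivariant vector with entries in
    K(V') defines an equivariant specialization from K(V) to K(V') that is
    faithful on the residues of E.  The coordinates of such a vector over
    K(V')^G may be chosen in that field, which is infinite even if K is finite,
    and can thus avoid the zeros of any given polynomial.

    Let W be a faithful representation of G / <sigma> and let chi be the
    character that is nontrivial on sigma.  Then V = W + chi is faithful for G
    and K(V) = K(W)(x) with g x = chi(g)^-1 x.  If E in K(W) compresses the
    action of G / <sigma>, then E(x) compresses that of G
    ([compressible_twisted]), so ed(G) <= ed(G / <sigma>) + 1.

    For the other inequality let E in K(W)(x) compress the action of G, and
    specialize x to 0, which is the residue map of a discrete valuation.  As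
    sigma acts trivially on K(W) but not on E, the field E contains elements of
    positive valuation, and the field E' of residues has smaller transcendence
    degree.  The point is that the kernel N of the action of G on E' is only
    <sigma> ([residue_kernel_cyclic]).  For a uniformizer t of E, sending g to
    the residue of g t / t embeds N in the units of K(W): an element of N with
    trivial image for every choice of t is wildly ramified, and these form a
    normal subgroup whose order has no prime divisor but the characteristic,
    which is therefore trivial ([wild_kernel_trivial]).  So N is cyclic, its image consists of roots of
    unity of K(W), which lie in K ([ratfun_root_of_unity]); since G fixes these,
    N is central, and the hypothesis on roots of unity forces N = <sigma>. *)

(** * Classical logic *)

Definition decide (P : Prop) : bool :=
  if excluded_middle_informative P then true else false.

Lemma decideP (P : Prop) : reflect P (decide P).
Proof. by rewrite /decide; case: excluded_middle_informative; constructor. Qed.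

Lemma nat_least (P : nat -> Prop) : (exists n, P n) ->
  exists n, P n /\ forall m, P m -> (n <= m)%N.
Proof.
case=> n Pn; apply: NNPP => no_least.
suff nP k m : (m < k)%N -> ~ P m by apply: (nP n.+1 n).
elim: k m => // k IHk m; rewrite ltnS => lemk Pm; apply: no_least; exists m.
split=> // j Pj; rewrite leqNgt; apply/negP => ltjm.
exact: IHk (leq_trans ltjm lemk) Pj.
Qed.

(** * Subfields and algebraic elements *)

Section SubfieldTheory.
Variable L : fieldType.
Implicit Types (A F S : L -> Prop) (x y : L).

Section Closure.
Variables (S : L -> Prop) (sfS : subfield S).

Lemma subfield1 : S 1. Proof. by case: sfS. Qed.
Lemma subfieldB x y : S x -> S y -> S (x - y).
Proof. by case: sfS => _ + _; apply. Qed.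
Lemma subfieldV x : S x -> S x^-1.
Proof. by case: sfS => S1 _ Sdiv Sx; rewrite -[_^-1]div1r; apply: Sdiv. Qed.
Lemma subfield0 : S 0.
Proof. by rewrite -(subrr 1); apply: subfieldB subfield1 subfield1. Qed.
Lemma subfieldN x : S x -> S (- x).
Proof. by rewrite -sub0r; apply: subfieldB subfield0. Qed.
Lemma subfieldD x y : S x -> S y -> S (x + y).
Proof. by move=> Sx /subfieldN Sy; rewrite -[y]opprK; apply: subfieldB. Qed.
Lemma subfieldM x y : S x -> S y -> S (x * y).
Proof.
case: sfS => _ _ Sdiv Sx /subfieldV Sy.
by rewrite -[y]invrK; apply: Sdiv.
Qed.
Lemma subfieldX x n : S x -> S (x ^+ n).
Proof.
move=> Sx; elim: n => [|n IHn]; first exact: subfield1.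
by rewrite exprS; apply: subfieldM.
Qed.
Lemma subfieldXz x (k : int) : S x -> S (x ^ k).
Proof. by case: k => n Sx; [|apply: subfieldV]; apply: subfieldX. Qed.
Lemma subfield_sum (I : Type) (r : seq I) (P : pred I) (f : I -> L) :
  (forall i, P i -> S (f i)) -> S (\sum_(i <- r | P i) f i).
Proof. by apply: big_ind; [apply: subfield0 | apply: subfieldD]. Qed.
Lemma subfield_nat n : S n%:R.
Proof.
elim: n => [|n IHn]; first exact: subfield0.
by rewrite mulrS; apply: subfieldD => //; apply: subfield1.
Qed.
Lemma subfield_horner (p : {poly L}) x : (forall i, S p`_i) -> S x -> S p.[x].
Proof.
move=> Sp Sx; rewrite horner_coef; apply: subfield_sum => i _.
by apply: subfieldM => //; apply: subfieldX.
Qed.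

Definition subfield_pred (_ : subfield S) : {pred L} := fun x => decide (S x).

Lemma subfield_predP x : reflect (S x) (x \in subfield_pred sfS).
Proof. by rewrite unfold_in; apply: decideP. Qed.

Lemma subfield_pred_divring_closed : divring_closed (subfield_pred sfS).
Proof.
case: sfS => S1 SB Sdiv; split; first exact/subfield_predP.
- by move=> x y /subfield_predP Sx /subfield_predP Sy; apply/subfield_predP/SB.
- by move=> x y /subfield_predP ? /subfield_predP ?; apply/subfield_predP/Sdiv.
Qed.
HB.instance Definition _ := GRing.isDivringClosed.Build L (subfield_pred sfS)
  subfield_pred_divring_closed.

(** The subfield as a field in its own right, so that the theory of integral
    elements and of matrices over a field applies to it. *)
Definition subfield_type : Type := {x : L | x \in subfield_pred sfS}.
HB.instance Definition _ := SubType.on subfield_type.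
HB.instance Definition _ := Choice.on subfield_type.
HB.instance Definition _ := [SubChoice_isSubIntegralDomain of subfield_type by <:].
HB.instance Definition _ := [SubIntegralDomain_isSubField of subfield_type by <:].

End Closure.

Lemma subfieldI S1 S2 : subfield S1 -> subfield S2 ->
  subfield (fun x => S1 x /\ S2 x).
Proof.
move=> [S1_1 S1B S1div] [S2_1 S2B S2div]; split=> // x y [? ?] [? ?]; split;
  by [apply: S1B | apply: S2B | apply: S1div | apply: S2div].
Qed.

Section Generated.
Implicit Types (s t : seq L).

Lemma generated_subfield A : subfield (generated_field A).
Proof.
split=> [S sfS _|x y Ax Ay S sfS AS|x y Ax Ay S sfS AS].
- exact: subfield1.
- by apply: (subfieldB sfS); [apply: Ax | apply: Ay].
- by case: (sfS) => _ _; apply; [apply: Ax | apply: Ay].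
Qed.

Lemma generated_base A : subpred_of A (generated_field A).
Proof. by move=> x Ax S _; apply. Qed.

(** The field F(s). *)
Definition fadjoin F s : L -> Prop := generated_field (fun y => F y \/ y \in s).

Lemma fadjoin_subfield F s : subfield (fadjoin F s).
Proof. exact: generated_subfield. Qed.

Lemma fadjoin_base F s : subpred_of F (fadjoin F s).
Proof. by move=> x Fx; apply: generated_base; left. Qed.

Lemma fadjoin_mem F s x : x \in s -> fadjoin F s x.
Proof. by move=> sx; apply: generated_base; right. Qed.

Lemma fadjoin_min F s S : subfield S -> subpred_of F S ->
  (forall y, y \in s -> S y) -> subpred_of (fadjoin F s) S.
Proof. by move=> sfS FS sS x; apply=> // y []; [apply: FS | apply: sS]. Qed.

Lemma fadjoin_cons F x s :
  subpred_of (fadjoin F (x :: s)) (fadjoin (fadjoin F [:: x]) s) /\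
  subpred_of (fadjoin (fadjoin F [:: x]) s) (fadjoin F (x :: s)).
Proof.
split.
  apply: fadjoin_min; first exact: fadjoin_subfield.
    by move=> y Fy; do 2!apply: fadjoin_base.
  move=> y; rewrite inE => /orP[/eqP->|]; last exact: fadjoin_mem.
  by apply: fadjoin_base; apply: fadjoin_mem; rewrite mem_head.
apply: fadjoin_min; first exact: fadjoin_subfield.
  apply: fadjoin_min; [exact: fadjoin_subfield | exact: fadjoin_base |].
  by move=> y; rewrite inE => /eqP->; apply: fadjoin_mem; rewrite mem_head.
by move=> y sy; apply: fadjoin_mem; rewrite inE sy orbT.
Qed.

Lemma fadjoin1_frac F x z : subfield F -> fadjoin F [:: x] z ->
  exists p q : {poly L}, [/\ forall i, F p`_i, forall i, F q`_i,
    q.[x] != 0 & z = p.[x] / q.[x]].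
Proof.
move=> sfF; move: z; apply: fadjoin_min.
- have F1 i : F (1 : {poly L})`_i by rewrite coef1; apply: subfield_nat.
  split.
  + by exists 1, 1; rewrite hornerC divr1 oner_neq0.
  + move=> _ _ [p [q [Fp Fq nzq ->]]] [p' [q' [Fp' Fq' nzq' ->]]].
    exists (p * q' - p' * q), (q * q'); split; rewrite ?hornerE ?mulf_neq0 //.
    * move=> i; rewrite coefB !coefM; apply: subfieldB => //;
        by apply: subfield_sum => // j _; apply: subfieldM.
    * by move=> i; rewrite coefM; apply: subfield_sum => // j _; apply: subfieldM.
    * by rewrite -mulNr addf_div // mulNr.
  + move=> _ _ [p [q [Fp Fq nzq ->]]] [p' [q' [Fp' Fq' nzq' ->]]].
    have [p'0|nzp'] := eqVneq p'.[x] 0.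
      exists 0, 1; rewrite p'0 !hornerC mul0r invr0 mulr0 mul0r oner_neq0.
      by split=> // i; rewrite coef0; apply: subfield0.
    exists (p * q'), (q * p'); split; rewrite ?hornerE ?mulf_neq0 //.
    * by move=> i; rewrite coefM; apply: subfield_sum => // j _; apply: subfieldM.
    * by move=> i; rewrite coefM; apply: subfield_sum => // j _; apply: subfieldM.
    * by rewrite invf_div mulf_div.
- move=> y Fy; exists y%:P, 1; rewrite !hornerC divr1 oner_neq0; split=> // i.
    by rewrite coefC; case: ifP => // _; apply: subfield0.
  by rewrite coef1; apply: subfield_nat.
- move=> y; rewrite inE => /eqP->; exists 'X, 1.
  rewrite hornerX hornerC divr1 oner_neq0; split=> // i.
    by rewrite coefX; apply: subfield_nat.
  by rewrite coef1; apply: subfield_nat.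
Qed.

End Generated.

Section Algebraic.

Lemma subfield_poly_lift S (sfS : subfield S) (p : {poly L}) :
  (forall i, S p`_i) -> exists q : {poly subfield_type sfS}, p = map_poly val q.
Proof.
move=> Sp; exists (\poly_(i < size p) insubd 0 p`_i); apply/polyP => i.
rewrite coef_map coef_poly; case: ltnP => [_|lepi].
  by rewrite /= insubdK //; apply/subfield_predP.
by rewrite nth_default //= raddf0.
Qed.

Lemma algebraic_over_integral S (sfS : subfield S) x :
  algebraic_over S x <-> integralOver (val : subfield_type sfS -> L) x.
Proof.
rewrite -integral_algebraic; split.
  case=> p [nzp /(subfield_poly_lift sfS)[q def_p] px0]; exists q.
    by apply: contraNneq nzp => q0; rewrite def_p q0 rmorph0.
  by rewrite -[map_poly _ _]def_p.
case=> q nzq qx0; exists (map_poly (val : subfield_type sfS -> L) q); split=> //.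
  by rewrite map_poly_eq0.
by move=> i; rewrite coef_map; apply/subfield_predP/valP.
Qed.

Lemma algebraic_over_subfield S : subfield S -> subfield (algebraic_over S).
Proof.
move=> sfS; split=> [|x y|x y].
- exact/(algebraic_over_integral sfS)/integral1.
- move=> /(algebraic_over_integral sfS) ? /(algebraic_over_integral sfS) ?.
  exact/(algebraic_over_integral sfS)/integral_sub.
- move=> /(algebraic_over_integral sfS) ? /(algebraic_over_integral sfS) ?.
  exact/(algebraic_over_integral sfS)/integral_div.
Qed.

Lemma algebraic_over_base S x : subfield S -> S x -> algebraic_over S x.
Proof.
move=> sfS Sx; exists ('X - x%:P); rewrite polyXsubC_eq0 root_XsubC; split=> // i.
rewrite coefB coefX coefC; apply: subfieldB => //; first exact: subfield_nat.
by case: ifP => // _; apply: subfield0.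
Qed.

Lemma algebraic_over_sub A A' x :
  subpred_of A A' -> algebraic_over A x -> algebraic_over A' x.
Proof. by move=> AA' [p [nzp Ap px0]]; exists p; split=> // i; apply: AA'. Qed.

(** Algebraic over algebraic is algebraic: the coefficients of the
    annihilating polynomial are integral over S, hence so is its root. *)
Lemma algebraic_over_trans A S x : subfield S ->
  subpred_of A (algebraic_over S) -> algebraic_over A x -> algebraic_over S x.
Proof.
move=> sfS algA [p [nzp Ap px0]]; apply/(algebraic_over_integral sfS).
apply: integral_root nzp px0 _ => y /(nthP 0)[i _ <-].
exact/(algebraic_over_integral sfS)/algA.
Qed.

(** The coefficients of p are fractions in y over F; up to a common
    denominator d they are the values at y of polynomials over F. *)
Lemma clear_denominators F y (p : {poly L}) : subfield F ->
    (forall i, fadjoin F [:: y] p`_i) ->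
  exists (Q : {poly {poly L}}) (d : L), [/\ forall i j, F Q`_i`_j, d != 0 &
    map_poly (horner_eval y) Q = d *: p].
Proof.
move=> sfF Fp.
suff [Q [e [FQ _ nze def_p]]] : exists (Q : {poly {poly L}}) (e : {poly L}),
    [/\ forall i j, F Q`_i`_j, forall i, F e`_i, e.[y] != 0
       & map_poly (horner_eval y) Q = e.[y] *: p].
  by exists Q, e.[y].
elim/poly_ind: p Fp => [|p c IHp] Fp.
  exists 0, 1; rewrite rmorph0 scaler0 hornerC oner_neq0.
  split=> // [i j|i]; first by rewrite !coef0; apply: subfield0.
  by rewrite coef1; apply: subfield_nat.
have [i|Q [e [FQ Fe nze def_p]]] := IHp.
  by have:= Fp i.+1; rewrite coefD coefMX coefC addr0.
have:= Fp 0; rewrite coefD coefMX coefC add0r /=.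
case/(fadjoin1_frac sfF) => a [b [Fa Fb nzb def_c]].
have FM (u v : {poly L}) : (forall i, F u`_i) -> (forall i, F v`_i) ->
    forall i, F (u * v)`_i.
  move=> Fu Fv i; rewrite coefM; apply: subfield_sum => // j _.
  exact: subfieldM.
exists (b *: (Q * 'X) + (e * a)%:P), (e * b); split.
- move=> i j; rewrite coefD coefZ coefMX coefC coefD.
  apply: subfieldD => //.
    apply: (FM b) => // k; case: ifP => // _; rewrite coef0; exact: subfield0.
  case: ifP => _; first exact: (FM e).
  by rewrite coef0; apply: subfield0.
- exact: FM.
- by rewrite hornerM mulf_neq0.
- rewrite rmorphD /= map_polyC /= map_polyZ /= rmorphM /= map_polyX def_p.
  rewrite /horner_eval !hornerM def_c -scalerAl scalerA scalerDr mulrC.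
  congr (_ + _); rewrite -[RHS]mul_polyC -polyCM; congr _%:P.
  by rewrite -mulrA (mulrCA b.[y]) divff // mulr1.
Qed.


(** Clearing denominators turns the equation of x over F(y) into a polynomial
    relation between x and y over F. Read as an equation for y over F(x) it is
    nontrivial: each coefficient is a polynomial over F evaluated at x, which
    vanishes only if it is zero, since x is transcendental. *)
Lemma algebraic_exchange F x y : subfield F -> ~ algebraic_over F x ->
  algebraic_over (fadjoin F [:: y]) x -> algebraic_over (fadjoin F [:: x]) y.
Proof.
move=> sfF Fx [p [nzp Fp /rootP px0]].
have [Q [d [FQ nzd def_p]]] := clear_denominators sfF Fp.
exists Q.[x%:P]; split.
- apply/eqP => Qx0.
  (* All the coefficients of Q in the other variable vanish at x. *)
  have Q0 : Q = 0.
    apply/polyP => i; apply/polyP => j; rewrite !coef0.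
    pose q := \poly_(k < size Q) Q`_k`_j.
    have qx0 : root q x.
      apply/rootP; transitivity Q.[x%:P]`_j; last by rewrite Qx0 coef0.
      rewrite horner_poly [in RHS]horner_coef coef_sum.
      by apply: eq_bigr => k _; rewrite -rmorphXn /= coefMC.
    have [q0|nzq] := eqVneq q 0.
      have <- : q`_i = Q`_i`_j; last by rewrite q0 coef0.
      by rewrite coef_poly; case: ltnP => // leQi; rewrite (nth_default _ leQi) coef0.
    case: Fx; exists q; split=> // k; rewrite coef_poly; case: ifP => // _.
    exact: subfield0.
  have:= def_p; rewrite Q0 rmorph0 => /esym/eqP.
  by rewrite scaler_eq0 (negPf nzd) (negPf nzp).
- move=> j; rewrite horner_coef coef_sum.
  have sfFx := @fadjoin_subfield F [:: x].
  apply: (subfield_sum sfFx) => k _; rewrite -rmorphXn /= coefMC.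
  apply: (subfieldM sfFx); first exact: fadjoin_base.
  by apply: (subfieldX sfFx); apply: fadjoin_mem; rewrite mem_head.
- apply/rootP.
  have -> : Q.[x%:P].[y] = (map_poly (horner_eval y) Q).[x].
    rewrite [Q.[_]]horner_coef horner_sum.
    rewrite (@horner_coef_wide _ (size Q)) ?size_poly //.
    by apply: eq_bigr => k _; rewrite coef_map hornerM horner_exp hornerC.
  by rewrite def_p hornerZ px0 mulr0.
Qed.

End Algebraic.

(** * Transcendence degree *)

Section TranscendenceDegree.
Implicit Types (s t u : seq L) (E : L -> Prop) (d : nat).

(** Algebraic independence over F, one element at a time: each member of s is
    transcendental over the field generated by its predecessors. Unlike the
    vanishing of polynomials in several variables, this form lends itself to
    induction with a growing base field. *)
Fixpoint alg_free F s : Prop :=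
  if s is x :: s' then ~ algebraic_over F x /\ alg_free (fadjoin F [:: x]) s'
  else True.

(** Defined by independent families rather than by a transcendence basis, so
    that it passes to subfields and, by lifting, to fields of residues. *)
Definition trdeg_le F E d : Prop :=
  forall s, (forall x, x \in s -> E x) -> alg_free F s -> (size s <= d)%N.

Lemma fadjoin_sub F s F' s' : subpred_of F (fadjoin F' s') ->
  (forall x, x \in s -> fadjoin F' s' x) ->
  subpred_of (fadjoin F s) (fadjoin F' s').
Proof. by move=> FF' ss'; apply: fadjoin_min => //; apply: fadjoin_subfield. Qed.

Lemma fadjoin_nil F : subfield F -> subpred_of (fadjoin F [::]) F.
Proof. by move=> sfF; apply: fadjoin_min => // x. Qed.

(** Let y be the first member of t such that x is algebraic over the field
    generated by F and the members of t up to y; then x and y can be exchanged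
    over the field generated by the members before y. *)
Lemma exchange_spanning F x t : subfield F -> ~ algebraic_over F x ->
    algebraic_over (fadjoin F t) x ->
  exists t1 y t2, t = t1 ++ y :: t2 /\
    algebraic_over (fadjoin F (x :: t1 ++ t2)) y.
Proof.
elim: t F => [|z t IHt] F sfF Fx.
  by move/(algebraic_over_sub (fadjoin_nil sfF)).
have [Fzx _|Fzx] := classic (algebraic_over (fadjoin F [:: z]) x).
  exists [::], z, t; split=> //=.
  have := algebraic_exchange sfF Fx Fzx; apply: algebraic_over_sub.
  apply: fadjoin_sub => [w Fw|w]; first exact: fadjoin_base.
  by rewrite inE => /eqP->; apply: fadjoin_mem; rewrite mem_head.
move/(algebraic_over_sub (fadjoin_cons F z t).1).
case/(IHt _ (@fadjoin_subfield F [:: z]) Fzx) => t1 [y [t2 [-> alg_y]]].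
exists (z :: t1), y, t2; split=> //; apply: algebraic_over_sub alg_y.
apply: fadjoin_sub => [|w].
  apply: fadjoin_sub => [w Fw|w]; first exact: fadjoin_base.
  by rewrite inE => /eqP->; apply: fadjoin_mem; rewrite !inE eqxx orbT.
rewrite inE => /orP[/eqP->|tw]; apply: fadjoin_mem; first exact: mem_head.
by rewrite !inE tw !orbT.
Qed.

(** Steinitz: the head x of u replaces some member of t, and then F(x) becomes
    the base field for the remaining members of u and of t. *)
Lemma alg_free_size F t u : subfield F ->
    (forall x, x \in u -> algebraic_over (fadjoin F t) x) -> alg_free F u ->
  (size u <= size t)%N.
Proof.
elim: u F t => //= x u IHu F t sfF alg_u [Fx free_u].
have [t1 [y [t2 [def_t alg_y]]]] :=
  exchange_spanning sfF Fx (alg_u x (mem_head x u)).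
have sfFx := @fadjoin_subfield F [:: x].
rewrite def_t size_cat addnS ltnS -size_cat; apply: (IHu _ _ sfFx) => // z uz.
pose M := fadjoin (fadjoin F [:: x]) (t1 ++ t2).
have sfM : subfield M by apply: fadjoin_subfield.
apply: (@algebraic_over_trans (fadjoin F t) M) => //; last first.
  by apply: alg_u; rewrite inE uz orbT.
apply: fadjoin_min; first exact: algebraic_over_subfield.
  by move=> w Fw; apply: algebraic_over_base => //; do 2!apply: fadjoin_base.
move=> w; rewrite def_t mem_cat inE orbCA -mem_cat => /orP[/eqP->|tw].
  exact: algebraic_over_sub (fadjoin_cons F x (t1 ++ t2)).1 alg_y.
by apply: algebraic_over_base => //; apply: fadjoin_mem.
Qed.

Lemma alg_free_sub F F' s : subpred_of F F' -> alg_free F' s -> alg_free F s.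
Proof.
elim: s F F' => //= x s IHs F F' FF' [F'x free_s]; split.
  by apply: contra_not F'x; apply: algebraic_over_sub.
apply: IHs free_s; apply: fadjoin_sub; last by move=> y; apply: fadjoin_mem.
by move=> y /FF'; apply: fadjoin_base.
Qed.

Lemma alg_free_rcons F s x : subfield F ->
  alg_free F (rcons s x) <-> alg_free F s /\ ~ algebraic_over (fadjoin F s) x.
Proof.
elim: s F => [|y s IHs] F sfF /=.
  split=> [[Fx _]|[_ Fx]]; split=> //; apply: contra_not Fx.
    by apply: algebraic_over_sub; apply: fadjoin_nil.
  by apply: algebraic_over_sub => z; apply: fadjoin_base.
have [FysF FysF'] := fadjoin_cons F y s.
split=> [[Fy /(IHs _ (@fadjoin_subfield F [:: y]))[free_s Fx]]|[[Fy free_s] Fx]].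
  by split=> //; apply: contra_not Fx; apply: algebraic_over_sub.
split=> //; apply/(IHs _ (@fadjoin_subfield F [:: y])); split=> //.
by apply: contra_not Fx; apply: algebraic_over_sub.
Qed.

Lemma trdeg_le_basis F E d : subfield F -> trdeg_le F E d ->
  exists s, [/\ forall x, x \in s -> E x, alg_free F s, (size s <= d)%N
    & forall x, E x -> algebraic_over (fadjoin F s) x].
Proof.
move=> sfF leEd.
suff ext k s : (d < k + size s)%N -> (forall x, x \in s -> E x) ->
    alg_free F s -> exists t, [/\ forall x, x \in t -> E x, alg_free F t,
    (size t <= d)%N & forall x, E x -> algebraic_over (fadjoin F t) x].
  by apply: (ext d.+1 [::]); rewrite ?addn0.
elim: k s => [|k IHk] s ltd Es free_s.
  by have := leEd s Es free_s; rewrite leqNgt ltd.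
have [?|] := classic (forall x, E x -> algebraic_over (fadjoin F s) x).
  by exists s; split=> //; apply: leEd.
case/not_all_ex_not=> x /(imply_to_and (E x))[Ex Fx].
(* An element of E that is transcendental over F(s) extends s. *)
apply: (IHk (rcons s x)); first by rewrite size_rcons addnS -addSn.
  by move=> y; rewrite mem_rcons inE => /orP[/eqP->|/Es].
by apply/alg_free_rcons.
Qed.

Lemma trdeg_le_spanning F E t : subfield F ->
  (forall x, E x -> algebraic_over (fadjoin F t) x) -> trdeg_le F E (size t).
Proof.
by move=> sfF algE s Es; apply: alg_free_size => // x /Es/algE.
Qed.

End TranscendenceDegree.
End SubfieldTheory.

(** The uniqueness half of the universal property of polynomial rings, in the
    form in which all identities between substitutions are proved below. *)
Lemma mpoly_rmorph_eq (K : nzRingType) (A : nzRingType) n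
    (f g : {rmorphism {mpoly K[n]} -> A}) :
  (forall c, f c%:MP = g c%:MP) -> (forall i, f 'X_i = g 'X_i) -> f =1 g.
Proof.
move=> fgC fgX p; rewrite [p]mpolyE !rmorph_sum /=; apply: eq_bigr => m _.
rewrite -mul_mpolyC mpolyXE_id !rmorphM !rmorph_prod /= fgC; congr (_ * _).
by apply: eq_bigr => i _; rewrite !rmorphXn /= fgX.
Qed.

Section IndependentTuples.
Variables (K L : fieldType) (iota : {rmorphism K -> L}).

Lemma ground_field_subfield : subfield (ground_field iota).
Proof.
split=> [|_ _ [a ->] [b ->]|_ _ [a ->] [b ->]].
- by exists 1; rewrite rmorph1.
- by exists (a - b); rewrite rmorphB.
- by exists (a / b); rewrite fmorph_div.
Qed.

Lemma mpoly_expand_last n (q : {mpoly K[n.+1]}) :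
  (map_poly (@mwiden n K) (muni q)).['X_ord_max] = q.
Proof.
rewrite [RHS]mpolyE muniE rmorph_sum horner_sum; apply: eq_bigr => m _ /=.
rewrite map_polyZ hornerZ map_polyXn hornerXn /= mwidenZ mwidenX -scalerAl.
rewrite mpolyXn -mpolyXD; congr (_ *: 'X_[_]); apply/mnmP => i.
rewrite mnmDE mulmnE mnm1E; case: (unliftP ord_max i) => [j|] ->.
  have -> : lift ord_max j = widen_ord (leqnSn n) j by apply/val_inj/lift_max.
  rewrite mnmwiden_widen mnmE -val_eqE /= gtn_eqF ?addn0 //.
by rewrite mnmwiden_ordmax eqxx mul1n.
Qed.

Lemma mmap_expand_last n (t : 'I_n.+1 -> L) (q : {mpoly K[n.+1]}) :
  mmap iota t q =
    (map_poly (mmap iota (t \o widen_ord (leqnSn n))) (muni q)).[t ord_max].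
Proof.
rewrite -[in LHS](mpoly_expand_last q).
pose mt : {rmorphism {mpoly K[n.+1]} -> L} := mmap iota t.
rewrite -[mmap _ _ _]/(mt _) -horner_map /= mmapX mmap1U -map_poly_comp.
congr _.[_]; apply: eq_map_poly => r /=.
pose widen_n := widen_ord (leqnSn n).
have eq_mmap : mmap iota (t \o widen_n) =1 (mt \o @mwiden n K).
  apply: mpoly_rmorph_eq => [c|j] /=; first by rewrite mwidenC !mmapC.
  by rewrite mwidenX mnmwiden1 !mmapX !mmap1U.
exact/esym/eq_mmap.
Qed.

Lemma mmap_fadjoin n (t : 'I_n -> L) s (q : {mpoly K[n]}) :
  (forall i, t i \in s) -> fadjoin (ground_field iota) s (mmap iota t q).
Proof.
move=> ts; have sfs := @fadjoin_subfield _ (ground_field iota) s.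
rewrite [q]mpolyE rmorph_sum; apply: (subfield_sum sfs) => m _ /=.
rewrite mmapZ mmapX; apply: (subfieldM sfs).
  by apply: fadjoin_base; exists q@_m.
rewrite /mmap1; apply: big_ind => [|x y|i _].
- exact: subfield1.
- exact: subfieldM.
- by apply: (subfieldX sfs); apply: fadjoin_mem.
Qed.

(** A relation between the t i, seen as an equation for the last of them over
    the field generated by the others, must have zero coefficients; these are
    relations between fewer elements. *)
Lemma alg_free_mpoly n (t : 'I_n -> L) :
    alg_free (ground_field iota) [seq t i | i <- enum 'I_n] ->
  forall q : {mpoly K[n]}, mmap iota t q = 0 -> q = 0.
Proof.
elim: n t => [|n IHn] t.
  move=> _ q; rewrite [q]nvar0_mpolyC mmapC => /eqP.
  by rewrite fmorph_eq0 => /eqP->; exact: mpolyC0.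
rewrite enum_ordSr map_rcons -map_comp.
case/(alg_free_rcons _ _ ground_field_subfield) => free_t Ft q qt0.
set s := map _ _ in free_t Ft.
rewrite -[q]mpoly_expand_last; suff -> : muni q = 0 by rewrite rmorph0 horner0.
apply/polyP => i; rewrite coef0; apply: (IHn _ free_t).
pose P := map_poly (mmap iota (t \o widen_ord (leqnSn n))) (muni q).
rewrite -coef_map -/P; apply: NNPP => nzPi; case: Ft; exists P; split.
- by apply: contra_not_neq nzPi => ->; rewrite coef0.
- move=> j; rewrite coef_map /=; apply: mmap_fadjoin => k.
  by rewrite map_f ?mem_enum.
- by apply/rootP; rewrite -mmap_expand_last.
Qed.

Lemma alg_free_independent d (t : d.-tuple L) :
  alg_free (ground_field iota) t -> alg_independent iota t.
Proof. by rewrite -{1}(map_tnth_enum t); apply: alg_free_mpoly. Qed.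

Lemma trdeg_le_has_trdeg E d : trdeg_le (ground_field iota) E d ->
  exists2 e, (e <= d)%N & has_trdeg iota E e.
Proof.
case/(trdeg_le_basis ground_field_subfield) => s [Es free_s le_s alg_s].
exists (size s) => //; exists (in_tuple s); split.
- by move=> i; apply: Es; apply: mem_tnth.
- exact: alg_free_independent.
- move=> x /alg_s; apply: algebraic_over_sub; apply: fadjoin_min.
  + exact: generated_subfield.
  + by move=> y Ky; apply: generated_base; left.
  + move=> y sy; apply: generated_base; right.
    by have /tnthP[i ->] : y \in in_tuple s by []; exists i.
Qed.

Lemma has_trdeg_spanning E d : has_trdeg iota E d ->
  exists2 t : seq L, size t = d &
    forall x, E x -> algebraic_over (fadjoin (ground_field iota) t) x.
Proof.
case=> t [_ _ alg_t]; exists t; first exact: size_tuple.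
move=> x /alg_t; apply: algebraic_over_sub => y; apply.
  exact: fadjoin_subfield.
move=> z [Kz|[i ->]]; first exact: fadjoin_base.
by apply: fadjoin_mem; apply: mem_tnth.
Qed.

End IndependentTuples.

(** * Matrices over a subfield *)

Section MatricesOverSubfield.
Variables (L : fieldType) (S : L -> Prop) (sfS : subfield S).

Lemma subfield_mx_lift m n (A : 'M[L]_(m, n)) : (forall i j, S (A i j)) ->
  exists B : 'M[subfield_type sfS]_(m, n), A = map_mx val B.
Proof.
move=> SA; exists (\matrix_(i, j) insubd 0 (A i j)); apply/matrixP => i j.
by rewrite !mxE insubdK //; apply/subfield_predP.
Qed.

Lemma subfield_mx_val m n (B : 'M[subfield_type sfS]_(m, n)) i j :
  S (map_mx val B i j).
Proof. by rewrite mxE; apply/subfield_predP/valP. Qed.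

(** Multiplication by x on E has a matrix over S, of which x is an eigenvalue,
    so x is a root of its characteristic polynomial. *)
Lemma ext_degree_algebraic E d x : subfield E -> ext_degree S E d -> E x ->
  subpred_of S E -> algebraic_over S x.
Proof.
move=> sfE [b [Eb span_b]] Ex SE.
have [i|A defA] := @fin_all_exists _ _ (fun i (c : 'rV[L]_d) =>
    (forall j, S (c 0 j)) /\ x * b 0 i = \sum_j c 0 j * b 0 j).
  by have [c [Sc _]] := span_b _ (subfieldM sfE Ex (Eb i)); exists c.
have [C defC] : exists C : 'M[subfield_type sfS]_d,
    \matrix_(j, i) A i 0 j = map_mx val C.
  by apply: subfield_mx_lift => i j; rewrite mxE; have [] := defA j.
have [c [[_ def1] _]] := span_b 1 (subfield1 sfE).
have nz_b : b != 0.
  apply: contra_eqN def1 => /eqP->; rewrite big1 ?oner_eq0 // => i _.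
  by rewrite mxE mulr0.
have : eigenvalue (map_mx val C : 'M[L]_d) x.
  apply/eigenvalueP; exists b => //; rewrite -defC.
  apply/rowP => i; rewrite !mxE (defA i).2.
  by apply: eq_bigr => j _; rewrite mxE mulrC.
rewrite eigenvalue_root_char -(map_char_poly (val : subfield_type sfS -> L)).
move=> rootC; exists (map_poly (val : subfield_type sfS -> L) (char_poly C)).
split=> //; first by rewrite map_poly_eq0 monic_neq0 ?char_poly_monic.
by move=> i; rewrite coef_map; apply/subfield_predP/valP.
Qed.

End MatricesOverSubfield.

(** * Finite groups of automorphisms and compression *)

Section FieldActions.
Variables (K L : fieldType) (iota : {rmorphism K -> L}).
Variables (gT : finGroupType) (G : {group gT}).
Implicit Types (E S : L -> Prop) (d : nat).

Record field_action (act : gT -> L -> L) : Prop := FieldAction {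
  field_actD : forall g, g \in G -> {morph act g : x y / x + y};
  field_actM : forall g, g \in G -> {morph act g : x y / x * y};
  field_act_ground : forall g, g \in G -> forall a, act g (iota a) = iota a;
  field_act_id : forall x, act 1%g x = x;
  field_act_comp : forall g h, g \in G -> h \in G ->
    forall x, act (g * h)%g x = act g (act h x) }.

Variable act : gT -> L -> L.

Definition act_stable E : Prop :=
  forall g, g \in G -> forall x, E x -> E (act g x).

Definition act_faithful E : Prop :=
  forall g, g \in G -> (forall x, E x -> act g x = x) -> g = 1%g.

Definition act_fixed x : Prop := forall g, g \in G -> act g x = x.

(** In contrast to [defined_over] the larger field E is the one that is
    measured, and it has to be G-stable. *)
Definition compressible d : Prop := exists E,
  [/\ subfield E, subpred_of (ground_field iota) E, act_stable E,
      act_faithful E & trdeg_le (ground_field iota) E d].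

Hypothesis actP : field_action act.

Section OneElement.
Variables (g : gT) (Gg : g \in G).

(** act g is an automorphism only for g in G, so the membership proof is part
    of the data on which the canonical ring morphism structure depends. *)
Definition act_rmorph (_ : g \in G) : L -> L := act g.

Lemma act_rmorph_zmod : zmod_morphism (act_rmorph Gg).
Proof.
have act0 : act g 0 = 0 by rewrite -(rmorph0 iota) field_act_ground.
move=> x y; rewrite /act_rmorph (field_actD actP) //; congr (_ + _).
apply/eqP; rewrite -subr_eq0 opprK -(field_actD actP) //.
by rewrite addNr act0.
Qed.
HB.instance Definition _ :=
  GRing.isZmodMorphism.Build L L (act_rmorph Gg) act_rmorph_zmod.
Lemma act_rmorph_monoid : monoid_morphism (act_rmorph Gg).
Proof.
split; last exact: field_actM.
by rewrite /act_rmorph -(rmorph1 iota) field_act_ground.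
Qed.
HB.instance Definition _ :=
  GRing.isMonoidMorphism.Build L L (act_rmorph Gg) act_rmorph_monoid.

Lemma actE : act g = (act_rmorph Gg : {rmorphism L -> L}). Proof. by []. Qed.

Lemma act_sum (I : Type) (r : seq I) (P : pred I) (f : I -> L) :
  act g (\sum_(i <- r | P i) f i) = \sum_(i <- r | P i) act g (f i).
Proof. by rewrite actE rmorph_sum. Qed.

Lemma act_preim_subfield S : subfield S -> subfield (fun x => S (act g x)).
Proof.
move=> sfS; split=> [|x y Sx Sy|x y Sx Sy]; rewrite actE.
- by rewrite rmorph1; apply: subfield1.
- by rewrite rmorphB; apply: subfieldB.
- by rewrite fmorph_div; apply: subfieldM => //; apply: subfieldV.
Qed.

Lemma act_eq_subfield : subfield (fun x => act g x = x).
Proof.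
split=> [|x y gx gy|x y gx gy]; rewrite actE ?rmorph1 //.
- by rewrite rmorphB -actE gx gy.
- by rewrite fmorph_div -actE gx gy.
Qed.

End OneElement.

Lemma act_fixed_subfield : subfield act_fixed.
Proof.
split=> [g Gg|x y xG yG g Gg|x y xG yG g Gg].
- by rewrite (actE Gg) rmorph1.
- by rewrite (actE Gg) rmorphB -actE xG ?yG.
- by rewrite (actE Gg) fmorph_div -actE xG ?yG.
Qed.

Lemma act_fixed_ground : subpred_of (ground_field iota) act_fixed.
Proof. by move=> _ [a ->] g Gg; apply: field_act_ground. Qed.

Lemma actVK g x : g \in G -> act g^-1%g (act g x) = x.
Proof. by move=> Gg; rewrite -field_act_comp ?groupV // mulVg field_act_id. Qed.

(** The compositum E1 of the conjugates of E is stable. It is algebraic over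
    E0, because E is finite over E0 and G fixes E0 pointwise; and G is
    faithful on E1, because E and L^G together generate L. *)
Lemma defined_over_compressible E0 d :
    act_faithful (fun _ => True) ->
    defined_over iota act_fixed E0 -> has_trdeg iota E0 d ->
  compressible d.
Proof.
move=> faithL [sfE0 KE0 E0fix [E [sfE E0E [m [degE _]] compL]]] trE0.
have [t <- alg_t] := has_trdeg_spanning trE0.
pose E1 := generated_field (fun y => exists g x, [/\ g \in G, E x & y = act g x]).
have sfE1 : subfield E1 by apply: generated_subfield.
have EE1 : subpred_of E E1.
  move=> x Ex; apply: generated_base; exists 1%g, x.
  by split; rewrite ?(field_act_id actP).
exists E1; split=> //.
- by move=> x /KE0/E0E/EE1.
- move=> g Gg x E1x.
  apply: (E1x _ (act_preim_subfield Gg sfE1)) => _ [h [y [Gh Ey ->]]].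
  apply: generated_base; exists (g * h)%g, y.
  by rewrite groupM // field_act_comp.
- move=> g Gg fixE1; apply: faithL => // x _.
  apply: (compL x _ (act_eq_subfield Gg)) => y [Ey|fix_y]; last exact: fix_y.
  by apply: fixE1; apply: EE1.
- apply: trdeg_le_spanning; first exact: ground_field_subfield.
  move=> x; have sft := @fadjoin_subfield _ (ground_field iota) t.
  apply; first exact: algebraic_over_subfield.
  move=> _ [g [y [Gg Ey ->]]]; apply: (algebraic_over_trans (A := E0)) => //.
  have [p [nzp E0p py0]] := ext_degree_algebraic sfE0 sfE degE Ey E0E.
  exists p; split=> //; have -> : p = map_poly (act_rmorph Gg) p.
    by apply/polyP => i; rewrite coef_map /= -actE (E0fix _ (E0p i)).
  by rewrite (actE Gg) rmorph_root.
Qed.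

(** Dedekind's independence of characters. If h is the first automorphism of
    the relation, comparing the relation at b * c with the relation at b
    multiplied by act h c gives a shorter relation, with coefficients v g *
    (act g c - act h c), and faithfulness provides c with act g c different
    from act h c. *)
Lemma act_linear_independence E (s : seq gT) (v : gT -> L) :
    subfield E -> act_faithful E -> act_stable E ->
    uniq s -> {subset s <= G} ->
    (forall b, E b -> \sum_(g <- s) v g * act g b = 0) ->
  forall g, g \in s -> v g = 0.
Proof.
move=> sfE faithE stE; elim: s v => // h s IHs v /= /andP[s'h uniq_s] sG v0.
have Gh : h \in G by rewrite sG ?mem_head.
have sG' : {subset s <= G} by move=> g sg; rewrite sG // inE sg orbT.
have vs g : g \in s -> v g = 0.
  move=> sg; have Gg := sG' g sg.
  have [c [Ec gc]] : exists c, E c /\ act g c <> act h c.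
    apply: NNPP => /not_ex_all_not nogc; case/negP: s'h.
    suff /eqP : (h^-1 * g)%g = 1%g by rewrite -eq_mulVg1 => /eqP->.
    apply: faithE => [|c Ec]; first by rewrite groupM ?groupV.
    rewrite field_act_comp ?groupV //.
    have /not_and_or[]// := nogc c; move/NNPP => ->; exact: actVK.
  suff /eqP : v g * (act g c - act h c) = 0.
    by rewrite mulf_eq0 subr_eq0 => /orP[/eqP|/eqP/gc].
  apply: (IHs (fun g => v g * (act g c - act h c))) => // b Eb.
  transitivity (\sum_(k <- h :: s) v k * act k (b * c)
                 - (\sum_(k <- h :: s) v k * act k b) * act h c).
    rewrite !big_cons (field_actM actP) // mulrDl -mulrA opprD addrACA subrr.
    rewrite add0r mulr_suml -sumrB; apply: eq_big_seq => k sk.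
    rewrite (field_actM actP) ?sG' // mulrBr mulrBl !mulrA.
    by rewrite [_ * act k c * _]mulrAC [_ * act h c * _]mulrAC.
  by rewrite (v0 b Eb) (v0 _ (subfieldM sfE Eb Ec)) mul0r subr0.
move=> g; rewrite inE => /orP[/eqP->|]; last exact: vs.
have := v0 1 (subfield1 sfE).
rewrite big_cons (actE Gh) rmorph1 mulr1 big_seq big1 ?addr0 // => k sk.
by rewrite vs ?mul0r.
Qed.

Local Notation N := #|G|.
Local Notation e := (@enum_val _ (mem G)).

Lemma enum_val_group (i : 'I_N) : e i \in G. Proof. exact: enum_valP. Qed.

(** The rows (g b)_g with b in E span the whole space, for a linear form that
    vanishes on all of them would be a linear relation between the
    automorphisms. So rows can be added one by one until the matrix is square. *)
Lemma act_matrix_free E : subfield E -> act_faithful E -> act_stable E ->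
  exists b : 'I_N -> L, (forall i, E (b i)) /\
    \matrix_(i, j) act (e j) (b i) \in unitmx.
Proof.
move=> sfE faithE stE.
suff ext k : (k <= N)%N -> exists b : 'I_k -> L, (forall i, E (b i)) /\
    row_free (\matrix_(i < k, j < N) act (e j) (b i)).
  have [b [Eb free_b]] := ext N (leqnn N).
  by exists b; rewrite -row_free_unit.
elim: k => [|k IHk] ltkN.
  exists (fun _ => 0); split=> [[]//|].
  by apply: inj_row_free => v _; rewrite thinmx0.
have [b [Eb free_b]] := IHk (ltnW ltkN).
set B := \matrix_(i, j) _ in free_b.
have [u nzu Bu0] : exists2 u : 'rV[L]_N, u != 0 & B *m u^T = 0.
  have : kermx B^T != 0.
    rewrite -mxrank_eq0 mxrank_ker mxrank_tr (eqP free_b) subn_eq0 -ltnNge.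
    exact: ltkN.
  case/rowV0Pn => u /sub_kermxP uB0 nzu; exists u => //.
  by apply: trmx_inj; rewrite trmx_mul trmxK uB0 trmx0.
have [c [Ec nzc]] : exists c, E c /\ \sum_j u 0 j * act (e j) c <> 0.
  apply: NNPP => /not_ex_all_not noc; case/eqP: nzu; apply/rowP => j.
  pose v g := u 0 (enum_rank_in (enum_val_group j) g).
  have vE i : v (e i) = u 0 i by rewrite /v enum_valK_in.
  rewrite mxE -vE.
  apply: (act_linear_independence (E := E) (s := enum G)) => //.
  - exact: enum_uniq.
  - by move=> g; rewrite mem_enum.
  - move=> c Ec; rewrite big_enum /= big_enum_val.
    have /not_and_or[]// := noc c; move/NNPP => sum0.
    by rewrite -[RHS]sum0; apply: eq_bigr => i _; rewrite vE.
  - by rewrite mem_enum enum_val_group.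
rewrite -addn1; exists (fun i => if split i is inl i' then b i' else c); split.
  by move=> i; case: split.
pose r : 'rV[L]_N := \row_j act (e j) c.
have -> : \matrix_(i, j) act (e j) (if split i is inl i' then b i' else c)
    = col_mx B r.
  by apply/matrixP => i j; rewrite !mxE; case: split => i'; rewrite !mxE.
apply: inj_row_free => w; rewrite -[w]hsubmxK mul_row_col => wBr0.
have w2_0 : rsubmx w = 0.
  have /(congr1 (mulmxr u^T)) := wBr0.
  rewrite /= mulmxDl -!mulmxA Bu0 mulmx0 add0r mul0mx.
  move/matrixP/(_ 0 0); rewrite !mxE big_ord1 => /eqP; rewrite mulf_eq0.
  case/orP=> /eqP h; first by apply/rowP => i; rewrite ord1 h mxE.
  case: nzc; rewrite -[RHS]h mxE; apply: eq_bigr => j _.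
  by rewrite !mxE mulrC.
move: wBr0; rewrite w2_0 mul0mx addr0 => /eqP.
by rewrite mulmx_free_eq0 // => /eqP->; rewrite row_mx0.
Qed.

(** Artin: expressing x in terms of b with coefficients c in S^G means solving
    c *m B = y x, where y x lists the conjugates of x. The solution is unique
    over L, hence G-invariant, and it is rational over S. *)
Lemma act_fixed_basis S F (b : 'I_N -> L) : subfield S -> act_stable S ->
    (forall x, F x <-> S x /\ act_fixed x) -> (forall i, S (b i)) ->
    \matrix_(i, j) act (e j) (b i) \in unitmx ->
  forall x, S x -> exists! c : 'rV[L]_N, (forall i, F (c 0 i)) /\
    x = \sum_i c 0 i * (\row_i b i) 0 i.
Proof.
move=> sfS stS defF Sb; set B := \matrix_(i, j) _ => unitB.
have SB i j : S (B i j) by rewrite mxE; apply: stS; rewrite ?enum_val_group.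
pose y x : 'rV[L]_N := \row_j act (e j) x.
have coordP c x : c *m B = y x <->
    forall g, g \in G -> \sum_i c 0 i * act g (b i) = act g x.
  split=> [/rowP cB g Gg|cE].
    have := cB (enum_rank_in Gg g); rewrite !mxE enum_rankK_in // => <-.
    by apply: eq_bigr => i _; rewrite !mxE enum_rankK_in.
  apply/rowP => j; rewrite !mxE -cE ?enum_val_group //.
  by apply: eq_bigr => i _; rewrite !mxE.
move=> x Sx.
have cE (c : 'rV[L]_N) : (forall i, F (c 0 i)) -> x = \sum_i c 0 i * (\row_i b i) 0 i ->
    c *m B = y x.
  move=> Fc def_x; apply/coordP => g Gg; rewrite def_x (actE Gg) rmorph_sum.
  apply: eq_bigr => i _; rewrite rmorphM /= -actE mxE.
  by have [_ ->] := (defF _).1 (Fc i).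
exists (y x *m invmx B); split=> [|c [Fc /(cE c Fc) <-]]; last by rewrite mulmxK.
set c := y x *m _; have cB : c *m B = y x by rewrite mulmxKV.
split=> [i|].
  apply/defF; split=> [|g Gg].
    have [B' defB] := subfield_mx_lift sfS SB.
    have [|y' defy] := @subfield_mx_lift _ S sfS _ _ (y x).
      by move=> i0 j; rewrite mxE; apply: stS; rewrite ?enum_val_group.
    by rewrite /c defB defy -map_invmx -map_mxM; apply: subfield_mx_val.
  (* G permutes the equations of the linear system. *)
  have gcB : map_mx (act_rmorph Gg) c *m B = y x.
    apply/coordP => h Gh; have Ggh : (g^-1 * h)%g \in G by rewrite groupM ?groupV.
    have /(congr1 (act g)) := (coordP c x).1 cB _ Ggh.
    rewrite {1}(actE Gg) rmorph_sum -field_act_comp // mulKVg => <-.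
    apply: eq_bigr => j _; rewrite rmorphM mxE /= -actE -field_act_comp //.
    by rewrite mulKVg.
  have /rowP/(_ i) : map_mx (act_rmorph Gg) c = c.
    by apply: (can_inj (mulmxK unitB)); rewrite gcB cB.
  by rewrite mxE.
have /coordP/(_ _ (group1 G)) := cB; rewrite field_act_id // => <-.
by apply: eq_bigr => i _; rewrite mxE field_act_id.
Qed.

(** The same family b is a basis of E over E^G and of L over L^G. *)
Lemma compressible_defined_over d : compressible d ->
  exists E0 e, [/\ (e <= d)%N, defined_over iota act_fixed E0
    & has_trdeg iota E0 e].
Proof.
case=> E [sfE KE stE faithE trE]; pose E0 x := E x /\ act_fixed x.
have [|e le_ed trE0] := @trdeg_le_has_trdeg _ _ iota E0 d.
  by move=> s E0s; apply: trE => x /E0s[].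
have [b [Eb unitB]] := act_matrix_free sfE faithE stE.
exists E0, e; split=> //; split.
- exact: subfieldI sfE act_fixed_subfield.
- by move=> x Kx; split; [apply: KE | apply: act_fixed_ground].
- by move=> x [].
have basisL := @act_fixed_basis (fun _ => True) act_fixed b.
have {}basisL : forall x : L, exists! c : 'rV[L]_N,
    (forall i, act_fixed (c 0 i)) /\ x = \sum_i c 0 i * (\row_i b i) 0 i.
  by move=> x; apply: basisL => // y; split=> [|[]].
exists E; split=> //; first by move=> x [].
  exists N; split; exists (\row_i b i); split=> // [i|]; first by rewrite mxE.
  exact: (act_fixed_basis (S := E)).
move=> x; have [c [[Gc ->] _]] := basisL x.
have sfEL : subfield (compositum E act_fixed) by apply: generated_subfield.
apply: (subfield_sum sfEL) => i _; rewrite mxE.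
by apply: (subfieldM sfEL); apply: generated_base; [right | left].
Qed.

Lemma ed_ext_is_compressible d : act_faithful (fun _ => True) ->
    compressible d -> (forall e, compressible e -> (d <= e)%N) ->
  ed_ext_is iota act_fixed d.
Proof.
move=> faithL /compressible_defined_over[E0 [e [le_ed defE0 trE0]]] min_d.
have comp_e := defined_over_compressible faithL.
split=> [|E1 e1 defE1 trE1]; last exact: min_d (comp_e _ _ defE1 trE1).
exists E0; split=> //; suff -> : d = e by [].
by apply/eqP; rewrite eqn_leq le_ed (min_d _ (comp_e _ _ defE0 trE0)).
Qed.

End FieldActions.

(** * Specializations and residues *)

Section Specialization.
Variables (L L' : fieldType) (R : L -> L' -> Prop).
Implicit Types (F E : L -> Prop).

(** The graph of a ring morphism from a local subring of L to L', mapping the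
    maximal ideal to 0 (a place, except that the subring need not be a
    valuation ring). As a relation it needs no choice of a domain. *)
Record specialization : Prop := Specialization {
  spec_one : R 1 1;
  specB : forall x x' y y', R x y -> R x' y' -> R (x - x') (y - y');
  specM : forall x x' y y', R x y -> R x' y' -> R (x * x') (y * y');
  specV : forall x y, R x y -> y != 0 -> R x^-1 y^-1;
  spec_zero : forall y, R 0 y -> y = 0 }.

Arguments specB _ {x x' y y'}.
Arguments specM _ {x x' y y'}.
Arguments specV _ {x y}.
Arguments spec_zero _ {y}.

(** The residues of E form a subfield of L', because the inverse of a nonzero
    residue is again a residue. *)
Definition residue E (y : L') : Prop := exists x, E x /\ R x y.

Definition spec_total F : Prop := forall x, F x -> exists y, R x y.

Hypothesis RP : specialization.

Lemma spec0 : R 0 0.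
Proof.
rewrite -(subrr 1) -[X in R _ X](subrr 1).
by apply: (specB RP); apply: (spec_one RP).
Qed.

Lemma spec_uniq x y y' : R x y -> R x y' -> y = y'.
Proof.
move=> Rxy Rxy'; apply/eqP; rewrite -subr_eq0; apply/eqP; apply: (spec_zero RP).
by rewrite -(subrr x); apply: (specB RP).
Qed.

Lemma specD x x' y y' : R x y -> R x' y' -> R (x + x') (y + y').
Proof.
move=> Rxy Rxy'; rewrite -[x']opprK -[y']opprK; apply: (specB RP) => //.
by rewrite -[- x']sub0r -[- y']sub0r; apply: (specB RP) => //; apply: spec0.
Qed.

Lemma specX x y n : R x y -> R (x ^+ n) (y ^+ n).
Proof.
move=> Rxy; elim: n => [|n IHn]; first exact: (spec_one RP).
by rewrite !exprS; apply: (specM RP).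
Qed.

Lemma specXz x y (k : int) : R x y -> y != 0 -> R (x ^ k) (y ^ k).
Proof.
case: k => n Rxy nzy; first exact: specX.
by rewrite !NegzE; apply: (specV RP); [apply: specX | rewrite expf_neq0].
Qed.

Lemma spec_sum (I : Type) (r : seq I) (f : I -> L) (f' : I -> L') :
  (forall i, R (f i) (f' i)) -> R (\sum_(i <- r) f i) (\sum_(i <- r) f' i).
Proof.
move=> Rf; apply: (big_ind2 R) => [|x y x' y' Rxy Rxy'|i _].
- exact: spec0.
- exact: specD.
- exact: Rf.
Qed.

Lemma spec_horner (p : {poly L}) (p' : {poly L'}) x y :
  (forall i, R p`_i p'`_i) -> R x y -> R p.[x] p'.[y].
Proof.
move=> Rp Rxy; pose n := maxn (size p) (size p').
rewrite (@horner_coef_wide _ n) ?leq_maxl // (@horner_coef_wide _ n) ?leq_maxr //.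
by apply: spec_sum => i; apply: (specM RP); rewrite ?Rp //; apply: specX.
Qed.

Lemma residue_subfield E : subfield E -> subfield (residue E).
Proof.
move=> sfE; split=> [|y y' [x [Ex Rx]] [x' [Ex' Rx']]|y y' [x [Ex Rx]] [x' [Ex' Rx']]].
- by exists 1; split; [apply: subfield1 | apply: (spec_one RP)].
- by exists (x - x'); split; [apply: subfieldB | apply: (specB RP)].
have [->|nzy'] := eqVneq y' 0.
  by exists 0; rewrite invr0 mulr0; split; [apply: subfield0 | apply: spec0].
exists (x / x'); split; first by apply: subfieldM => //; apply: subfieldV.
by apply: (specM RP) => //; apply: (specV RP).
Qed.

Section TotalSubfield.
Variables (F : L -> Prop) (sfF : subfield F) (totF : spec_total F).

Lemma spec_total_inj x : F x -> R x 0 -> x = 0.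
Proof.
move=> Fx Rx0; apply/eqP/negP => nzx.
have [y Rxy] := totF (subfieldV sfF Fx).
have := (specM RP) Rx0 Rxy; rewrite mul0r divff; last exact/negP.
by move=> R10; have /eqP := spec_uniq (spec_one RP) R10; rewrite oner_eq0.
Qed.

Lemma spec_poly_lift (p : {poly L}) : (forall i, F p`_i) ->
  exists p' : {poly L'}, forall i, R p`_i p'`_i.
Proof.
move=> Fp; have [i|c Rc] := @fin_all_exists 'I_(size p) _ (fun i y => R p`_i y).
  exact: totF.
exists (\poly_(i < size p) oapp c 0 (insub i)) => i; rewrite coef_poly.
case: ltnP => [ltip|lepi]; last by rewrite nth_default //; apply: spec0.
by rewrite insubT /=; apply: (Rc (Ordinal ltip)).
Qed.

Lemma spec_poly_lift_neq0 (p : {poly L}) (p' : {poly L'}) :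
  (forall i, F p`_i) -> (forall i, R p`_i p'`_i) -> p != 0 -> p' != 0.
Proof.
move=> Fp Rp; apply: contra_neq => p'0; apply/polyP => i; rewrite coef0.
by apply: spec_total_inj => //; have := Rp i; rewrite p'0 coef0.
Qed.

(** If all elements of F have residues then F embeds in L', and an equation of
    x over F specializes to a nonzero equation of its residue. *)
Lemma spec_transcendental x y : R x y ->
  ~ algebraic_over (residue F) y -> ~ algebraic_over F x.
Proof.
move=> Rxy; apply: contra_not => -[p [nzp Fp /rootP px0]].
have [p' Rp] := spec_poly_lift Fp; exists p'; split.
- exact: spec_poly_lift_neq0 nzp.
- by move=> i; exists p`_i.
- apply/rootP; apply: (spec_zero RP); rewrite -px0; exact: spec_horner.
Qed.

(** Since y is transcendental, the denominator of a fraction in x over F has a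
    nonzero residue, so the specialization extends to all of F(x). *)
Lemma spec_fadjoin x y : R x y -> ~ algebraic_over (residue F) y ->
  forall z, fadjoin F [:: x] z ->
  exists2 w, fadjoin (residue F) [:: y] w & R z w.
Proof.
move=> Rxy Fy z /(fadjoin1_frac sfF)[p [q [Fp Fq nzq ->]]].
have [[p' Rp] [q' Rq]] := (spec_poly_lift Fp, spec_poly_lift Fq).
have sfy := @fadjoin_subfield _ (residue F) [:: y].
have y_y : fadjoin (residue F) [:: y] y by apply: fadjoin_mem; rewrite mem_head.
have nzq' : q'.[y] != 0.
  apply/negP => q'y0; apply: Fy; exists q'; split=> //.
    apply: spec_poly_lift_neq0 Rq _ => //.
    by apply: contraNneq nzq => ->; rewrite horner0.
  by move=> i; exists q`_i.
exists (p'.[y] / q'.[y]).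
  apply: (subfieldM sfy); last apply: (subfieldV sfy);
    apply: (subfield_horner sfy) => // i; apply: fadjoin_base;
    by [exists p`_i | exists q`_i].
by apply: (specM RP); [|apply: (specV RP) => //]; apply: spec_horner.
Qed.

(** An algebraic equation p(x) = 0 specializes to p(0) = 0, so p is divisible
    by X, and division by X gives an equation of smaller degree. *)
Lemma spec_kernel_transcendental x : x != 0 -> R x 0 -> ~ algebraic_over F x.
Proof.
move=> nzx Rx [p [nzp Fp /rootP px0]].
elim/poly_ind: p nzp Fp px0 => [|p c IHp]; first by rewrite eqxx.
move=> nzp Fpc pcx0.
have Fp i : F p`_i.
  by have := Fpc i.+1; rewrite coefD coefMX coefC addr0.
have Fc : F c by have := Fpc 0; rewrite coefD coefMX coefC add0r.
have [p' Rp] := spec_poly_lift Fp.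
have c0 : c = 0.
  apply: spec_total_inj => //; move/eqP: pcx0.
  rewrite hornerD hornerMX hornerC addr_eq0 => /eqP pxE.
  rewrite -[c]opprK -pxE -sub0r -[X in R _ X](subrr 0).
  apply: (specB RP); first exact: spec0.
  by rewrite -(mulr0 p'.[0]); apply: (specM RP) => //; apply: spec_horner.
apply: IHp => //; first by apply: contraNneq nzp => ->; rewrite c0 mul0r addr0.
by move/eqP: pcx0; rewrite c0 addr0 hornerMX mulf_eq0 (negPf nzx) orbF => /eqP.
Qed.

End TotalSubfield.

Lemma spec_alg_free F (s : seq (L * L')) : subfield F -> spec_total F ->
    (forall z, z \in s -> R z.1 z.2) -> alg_free (residue F) (unzip2 s) ->
  alg_free F (unzip1 s) /\ spec_total (fadjoin F (unzip1 s)).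
Proof.
elim: s F => [|[x y] s IHs] F sfF totF Rs /=.
  by move=> _; split=> // x /(fadjoin_nil sfF)/totF.
case=> Fy free_s; have Rxy : R x y by apply: (Rs (x, y)); rewrite mem_head.
have Fxy := spec_fadjoin sfF totF Rxy Fy.
have [] := IHs (fadjoin F [:: x]).
- exact: fadjoin_subfield.
- by move=> z /Fxy[w _ Rzw]; exists w.
- by move=> z sz; apply: Rs; rewrite inE sz orbT.
- apply: alg_free_sub free_s => v [z [/Fxy[w Fyw Rzw] Rzv]].
  by rewrite (spec_uniq Rzv Rzw).
move=> free_xs tot_s; split; first by split=> //; apply: spec_transcendental Rxy Fy.
by move=> z /(fadjoin_cons F x (unzip1 s)).1/tot_s.
Qed.

Lemma residue_lift E (ys : seq L') : (forall y, y \in ys -> residue E y) ->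
  exists2 s : seq (L * L'), unzip2 s = ys &
    forall z, z \in s -> E z.1 /\ R z.1 z.2.
Proof.
elim: ys => [|y ys IHys] Eys; first by exists [::].
have [x [Ex Rxy]] := Eys y (mem_head y ys).
have [z sz|s <- Es] := IHys; first by apply: Eys; rewrite inE sz orbT.
by exists ((x, y) :: s) => // z; rewrite inE => /orP[/eqP->|/Es].
Qed.

Section ResidueDegree.
Variables (F E : L -> Prop) (F' : L' -> Prop) (d : nat).
Hypotheses (sfF : subfield F) (totF : spec_total F).
Hypotheses (FF' : subpred_of (residue F) F') (trE : trdeg_le F E d).

Lemma residue_trdeg_le : trdeg_le F' (residue E) d.
Proof.
move=> ys /residue_lift[s <- Es] /(alg_free_sub FF') free_s.
rewrite size_map -(size_map fst); apply: trE.
  by move=> _ /mapP[z sz ->]; have [] := Es z sz.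
by have [|] := spec_alg_free sfF totF _ free_s => // z /Es[].
Qed.

(** Lifts of independent residues remain independent after x is added to them. *)
Lemma residue_trdeg_lt x : E x -> x != 0 -> R x 0 ->
  exists2 d', d = d'.+1 & trdeg_le F' (residue E) d'.
Proof.
move=> Ex nzx Rx0.
have ltd ys : (forall y, y \in ys -> residue E y) -> alg_free F' ys ->
    (size ys < d)%N.
  move=> /residue_lift[s <- Es] /(alg_free_sub FF') free_s.
  have [|free_s1 tot_s] := spec_alg_free sfF totF _ free_s.
    by move=> z /Es[].
  rewrite size_map -(size_map fst) -(size_rcons _ x); apply: trE.
    move=> z; rewrite mem_rcons inE => /orP[/eqP->//|/mapP[w sw ->]].
    by have [] := Es w sw.
  apply/(alg_free_rcons _ _ sfF); split=> //.
  by apply: spec_kernel_transcendental => //; apply: fadjoin_subfield.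
case: d ltd => [|d'] ltd; first by suff: (0 < 0)%N by []; apply: (ltd [::]).
by exists d' => // ys Eys free_ys; rewrite -ltnS; apply: ltd.
Qed.

End ResidueDegree.
End Specialization.

(** * The kernel of the action on residues *)

Section ResidueAction.
Variables (K L L' : fieldType) (iota : {rmorphism K -> L}).
Variables (iota' : {rmorphism K -> L'}) (gT : finGroupType) (G : {group gT}).
Variables (act : gT -> L -> L) (act' : gT -> L' -> L').
Variables (R : L -> L' -> Prop) (E : L -> Prop).
Hypotheses (actP : field_action iota G act) (RP : specialization R).
Hypotheses (Rground : forall a, R (iota a) (iota' a)).
Hypothesis Ract : forall g, g \in G ->
  forall x y, R x y -> R (act g x) (act' g y).
Hypothesis sfE : subfield E.
Hypotheses (stE : act_stable G act E) (faithE : act_faithful G act E).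

Implicit Types (u v x : L) (y z : L') (g h : gT).

Lemma act'_ground g a : g \in G -> act' g (iota' a) = iota' a.
Proof.
move=> Gg; apply: (spec_uniq RP) (Rground a).
by rewrite -(field_act_ground actP Gg); apply: Ract.
Qed.

Lemma act'_1 g : g \in G -> act' g 1 = 1.
Proof. by move=> Gg; rewrite -(rmorph1 iota') act'_ground. Qed.

Definition spec_unit u : Prop := exists2 y, R u y & y != 0.

Lemma spec_unit_neq0 u : spec_unit u -> u != 0.
Proof.
case=> y Ruy; apply: contra_neq => u0; apply: (spec_zero RP).
by rewrite -u0.
Qed.

Lemma spec_unit_kernel u : spec_unit u -> ~ R u 0.
Proof. by case=> y Ruy /negP nzy /(spec_uniq RP Ruy)/eqP. Qed.

Lemma spec_unitM u v : spec_unit u -> spec_unit v -> spec_unit (u * v).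
Proof.
case=> y Ruy nzy [z Rvz nzz].
by exists (y * z); [apply: (specM RP) | rewrite mulf_neq0].
Qed.

Lemma spec_unitXz u (k : int) : spec_unit u -> spec_unit (u ^ k).
Proof.
case=> y Ruy nzy; exists (y ^ k); first exact: specXz.
by rewrite expfz_neq0.
Qed.

Lemma spec_unitV u : spec_unit u -> spec_unit u^-1.
Proof. exact: (@spec_unitXz u (-1)). Qed.

Lemma spec_unit_act g u : g \in G -> spec_unit u -> spec_unit (act g u).
Proof.
move=> Gg unit_u; have [y Ruy nzy] := unit_u.
exists (act' g y); first exact: Ract.
apply/eqP => gy0; apply: (spec_unit_kernel unit_u); have Gg' := groupVr Gg.
have := Ract Gg' (Ract Gg Ruy); rewrite (actVK actP) // gy0.
by rewrite -(rmorph0 iota') act'_ground.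
Qed.

Lemma act_rmorphXz g x (k : int) : g \in G -> act g (x ^ k) = act g x ^ k.
Proof. by move=> Gg; rewrite (actE actP Gg) fmorphXz. Qed.

Lemma act_rmorph_div g u v : g \in G -> act g (u / v) = act g u / act g v.
Proof. by move=> Gg; rewrite (actE actP Gg) fmorph_div. Qed.

Lemma act_eq0 g x : g \in G -> (act g x == 0) = (x == 0).
Proof. by move=> Gg; rewrite (actE actP Gg) fmorph_eq0. Qed.

(** A discrete valuation, with uniformizer w, in multiplicative form. *)
Definition discrete w : Prop := [/\ w != 0, R w 0 &
  forall x, x != 0 -> exists (k : int) u, x = w ^ k * u /\ spec_unit u].

(** The value group of E is generated by its least positive element, by
    Euclidean division. *)
Lemma spec_uniformizer w : discrete w ->
    (exists x, [/\ E x, x != 0 & R x 0]) ->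
  exists x, [/\ E x, x != 0, R x 0 & forall b, E b -> b != 0 ->
    exists (j : int) u, b = x ^ j * u /\ spec_unit u].
Proof.
case=> nzw Rw wP [x0 [Ex0 nzx0 Rx0]].
pose Q k := (0 < k)%N /\ exists x u, [/\ E x, spec_unit u & x = w ^+ k * u].
have [|k [[k_gt0 [x [u [Ex unit_u def_x]]]] min_k]] := @nat_least Q.
  have [[k|k] [u [def_x0 unit_u]]] := wP x0 nzx0.
    exists k; split; last by exists x0, u.
    case: k def_x0 => // def_x0; case: (spec_unit_kernel unit_u).
    by rewrite -[u]mul1r -(expr0z w) -def_x0.
  case: (spec_unit_kernel unit_u).
  have -> : u = w ^+ k.+1 * x0.
    by rewrite def_x0 NegzE -exprnN mulrA mulfV ?mul1r ?expf_neq0.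
  by rewrite -(mulr0 (0 ^+ k.+1)); apply: (specM RP) => //; apply: specX.
have nzu := spec_unit_neq0 unit_u.
have nzx : x != 0 by rewrite def_x mulf_neq0 ?expf_neq0.
have [y Ruy _] := unit_u.
exists x; split=> // [|b Eb nzb].
  rewrite def_x -(prednK k_gt0) exprS -mulrA -(mul0r (0 ^+ k.-1 * y)).
  by do 2!apply: (specM RP) => //; apply: specX.
have [i [v [def_b unit_v]]] := wP b nzb.
have k_neq0 : k%:Z != 0 by rewrite -lt0n.
set j := (i %/ k)%Z; set r := (i %% k)%Z.
have unit_vu : spec_unit (v * u ^ (- j)).
  by apply: spec_unitM => //; apply: spec_unitXz.
have def_bj : b * x ^ (- j) = w ^ r * (v * u ^ (- j)).
  rewrite def_b def_x expfzMl.
  rewrite mulrACA; congr (_ * _).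
  rewrite -[w ^+ k]/(w ^ k%:Z) exprz_exp -expfzDr //; congr (w ^ _).
  by rewrite [in LHS](divz_eq i k) mulrN [k%:Z * j]mulrC addrAC subrr add0r.
have r0 : r = 0.
  have r_ge0 : 0 <= r by apply: modz_ge0.
  have ltrk : r < k by apply: ltz_pmod.
  case def_r: r r_ge0 ltrk def_bj => [[|m]|m] // _ ltmk def_bj.
  (* The remainder r is the valuation of an element of E. *)
  have /min_k : Q m.+1.
    split=> //; exists (b * x ^ (- j)), (v * u ^ (- j)); split=> //.
    by apply: subfieldM => //; apply: subfieldXz.
  by rewrite leqNgt -ltz_nat ltmk.
exists j, (v * u ^ (- j)); split=> //.
rewrite -[RHS]mulrC -[_ * u ^ _]mul1r -(expr0z w) -r0 -def_bj -mulrA -expfzDr //.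
by rewrite addNr expr0z mulr1.
Qed.

(** Otherwise E has no elements of positive valuation, hence none of negative
    valuation, and consists of 0 and units; then E embeds in L' by the residue
    map and g acts trivially on E. *)
Lemma exists_uniformizer w g : discrete w -> g \in G -> g != 1%g ->
    (forall x y, E x -> R x y -> R (act g x) y) ->
  exists x, [/\ E x, x != 0 & R x 0].
Proof.
case=> nzw Rw wP Gg /eqP nt_g trivg; apply: NNPP => no_x; apply: nt_g.
have noE x : E x -> R x 0 -> x = 0.
  move=> Ex Rx; apply/eqP; apply: contraPT nzw => nzx _.
  by apply: no_x; exists x.
apply: faithE => // x Ex; have [->|nzx] := eqVneq x 0.
  by apply/eqP; rewrite act_eq0.
have [y Rxy] : exists y, R x y.
  have [[k|k] [u [def_x [y Ruy nzy]]]] := wP x nzx.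
    by exists (0 ^+ k * y); rewrite def_x; apply: (specM RP) => //; apply: specX.
  have nzu : u != 0 by apply: spec_unit_neq0; exists y.
  suff /eqP : x^-1 = 0 by rewrite invr_eq0 (negPf nzx).
  apply: noE; first exact: subfieldV.
  rewrite def_x NegzE -exprnN invfM invrK -(mul0r y^-1).
  apply: (specM RP); last exact: (specV RP).
  by rewrite exprS -(mul0r (0 ^+ k)); apply: (specM RP) => //; apply: specX.
apply/eqP; rewrite -subr_eq0; apply/eqP/noE.
  by apply: subfieldB => //; apply: stE.
by rewrite -(subrr y); apply: (specB RP) => //; apply: trivg.
Qed.

(** The inertia group of E. *)
Definition residue_kernel g : Prop :=
  g \in G /\ forall x y, E x -> R x y -> R (act g x) y.

(** The wild inertia group. If x is a unit, the condition on g x / x already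
    follows from the triviality on residues; it matters for uniformizers. *)
Definition wild_kernel g : Prop :=
  residue_kernel g /\ forall x, E x -> x != 0 -> R (act g x / x) 1.

Lemma residue_kernel1 : residue_kernel 1%g.
Proof. by split=> // x y Ex; rewrite (field_act_id actP). Qed.

Lemma residue_kernelM g h :
  residue_kernel g -> residue_kernel h -> residue_kernel (g * h)%g.
Proof.
move=> [Gg kg] [Gh kh]; split=> [|x y Ex Rxy]; first exact: groupM.
by rewrite (field_act_comp actP) //; apply: kg; [apply: stE | apply: kh].
Qed.

Lemma residue_kernelJ g h : g \in G -> residue_kernel h ->
  residue_kernel (h ^ g)%g.
Proof.
move=> Gg [Gh kh]; have Gg' := groupVr Gg.
split=> [|x y Ex Rxy]; first exact: groupJ.
rewrite conjgE !(field_act_comp actP) ?groupM //.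
have Rgxy : R (act g^-1%g (act h (act g x))) (act' g^-1%g (act' g y)).
  by apply: Ract => //; apply: kh; [apply: stE | apply: Ract].
suff -> : y = act' g^-1%g (act' g y) by [].
apply: (spec_uniq RP Rxy); rewrite -{1}(actVK actP x Gg).
by apply: (Ract Gg'); apply: Ract.
Qed.

Lemma residue_kernel_unit g u : residue_kernel g -> E u -> spec_unit u ->
  R (act g u / u) 1.
Proof.
move=> [Gg kg] Eu [y Ruy nzy]; rewrite -(divff nzy).
by apply: (specM RP) (kg _ _ Eu Ruy) _; apply: (specV RP).
Qed.

Lemma wild_kernel1 : wild_kernel 1%g.
Proof.
split=> [|x _ nzx]; first exact: residue_kernel1.
by rewrite (field_act_id actP) divff //; apply: spec_one.
Qed.

Lemma wild_kernelM g h : wild_kernel g -> wild_kernel h -> wild_kernel (g * h)%g.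
Proof.
move=> [kg wg] [kh wh]; have [[Gg _] [Gh _]] := (kg, kh).
split=> [|x Ex nzx]; first exact: residue_kernelM.
have nzhx : act h x != 0 by rewrite act_eq0.
rewrite (field_act_comp actP) // -[1]mulr1 -(divfK nzhx (act g _)) -[_ / x]mulrA.
by apply: (specM RP); [apply: wg => //; apply: stE | apply: wh].
Qed.

Lemma wild_kernelJ g h : g \in G -> wild_kernel h -> wild_kernel (h ^ g)%g.
Proof.
move=> Gg [kh wh]; have [Gh _] := kh; have Gg' := groupVr Gg.
split=> [|x Ex nzx]; first exact: residue_kernelJ.
have nzgx : act g x != 0 by rewrite act_eq0.
rewrite conjgE !(field_act_comp actP) ?groupM // -{2}(actVK actP x Gg).
rewrite -act_rmorph_div // -(act'_1 Gg').
by apply: Ract => //; apply: wh => //; apply: stE.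
Qed.

(** If q is invertible, subtracting from x its average over the powers of g
    leaves an element x' whose conjugates sum to 0. If x' is nonzero then,
    after division by x', these conjugates all have residue 1, so that q = 0.
    So x is its own average, and g acts trivially on E. *)
Lemma wild_kernel_order g q : prime q -> wild_kernel g -> #[g]%g = q ->
  q \in [pchar K].
Proof.
move=> pr_q wg ord_g; apply: contraPT (prime_gt1 pr_q).
rewrite inE pr_q /= -ord_g => nzq; rewrite order_gt1 => /eqP nt_g; apply: nt_g.
have wgi i : wild_kernel (g ^+ i)%g.
  elim: i => [|i IHi]; first by rewrite expg0; apply: wild_kernel1.
  by rewrite expgS; apply: wild_kernelM.
have Ggi i : (g ^+ i)%g \in G by have [[]] := wgi i.
have Gg : g \in G by have [[]] := wg.
apply: faithE => // x Ex.
have nzqL : #[g]%g%:R != 0 :> L by rewrite -(rmorph_nat iota) fmorph_eq0.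
pose c := \sum_(i < #[g]%g) act (g ^+ i)%g x.
have gc i : act (g ^+ i)%g c = c.
  elim: i => [|i IHi]; first by rewrite expg0 (field_act_id actP).
  rewrite expgS (field_act_comp actP) // IHi /c (actE actP Gg) rmorph_sum /=.
  rewrite -(actE actP Gg); case def_n: #[g]%g => [|n]; first by rewrite !big_ord0.
  rewrite [RHS]big_ord_recl [LHS]big_ord_recr /= addrC; congr (_ + _).
    by rewrite -(field_act_comp actP) // -expgS -def_n expg_order.
  by apply: eq_bigr => j _; rewrite -(field_act_comp actP) // -expgS.
pose x' := x - c / #[g]%g%:R.
have trx' : \sum_(i < #[g]%g) act (g ^+ i)%g x' = 0.
  under eq_bigr => i _.
    rewrite (actE actP (Ggi i)) rmorphB fmorph_div rmorph_nat /=.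
    rewrite -(actE actP (Ggi i)) gc; over.
  by rewrite sumrB -/c sumr_const card_ord -[X in _ - X]mulr_natr divfK // subrr.
have [x'0|nzx'] := eqVneq x' 0.
  have -> : x = c / #[g]%g%:R by apply/eqP; rewrite -subr_eq0 -/x' x'0.
  by have := gc 1%N; rewrite expg1 (actE actP Gg) fmorph_div rmorph_nat => ->.
have Ex' : E x'.
  apply: subfieldB => //; apply: subfieldM => //; last first.
    by apply: subfieldV => //; apply: subfield_nat.
  by apply: subfield_sum => // i _; apply: stE.
have : R 0 #[g]%g%:R.
  rewrite -(mul0r x'^-1) -trx' mulr_suml -[X in R _ X%:R]card_ord -sumr_const.
  by apply: spec_sum => // i; have [_] := wgi i; apply.
move/(spec_zero RP)/eqP; rewrite -(rmorph_nat iota') fmorph_eq0.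
by rewrite (negPf nzq).
Qed.

Lemma pchar_dvd_wild_kernel (P : {group gT}) :
  (forall g, g \in P -> wild_kernel g) ->
  forall q, prime q -> (q %| #|P|)%N -> q \in [pchar K].
Proof.
move=> wP q pr_q /(Cauchy pr_q)[g Pg ord_g].
exact: wild_kernel_order (wP g Pg) ord_g.
Qed.

(** This is what excludes a nontrivial wild inertia group. *)
Definition no_wild_subgroup : Prop :=
  [pchar K] =i pred0 \/ exists l : nat, l \in [pchar K] /\
     forall H : {group gT}, (H <| G)%g -> (l.-group H)%g -> (H :=: 1)%g.

Lemma wild_kernel_trivial g : no_wild_subgroup -> wild_kernel g -> g = 1%g.
Proof.
move=> no_wild wg.
pose P := [set h | decide (wild_kernel h)].
have inP h : reflect (wild_kernel h) (h \in P).
  by rewrite inE; apply: decideP.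
have gP : group_set P.
  apply/group_setP; split=> [|h k /inP wh /inP wk]; apply/inP.
    exact: wild_kernel1.
  exact: wild_kernelM.
have primeP q : prime q -> (q %| #|P|)%N -> q \in [pchar K].
  by apply: (@pchar_dvd_wild_kernel (Group gP)) => h /inP.
suff P1 : P = 1%g by move/inP: wg; rewrite P1 => /set1P.
case: no_wild => [char0 | [l [charl no_normal]]].
  apply/eqP; rewrite (@trivg_card1 _ (Group gP)) /=; apply: contraT => ntP.
  have := primeP _ (pdiv_prime _) (pdiv_dvd _); rewrite char0 inE; apply.
  by rewrite ltn_neqAle eq_sym ntP (cardG_gt0 (Group gP)).
apply: (no_normal (Group gP)).
  apply/normalP; split; first by apply/subsetP => h /inP[[]].
  move=> h Gh; apply/setP => k; rewrite mem_conjg; apply/inP/inP => wk.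
    by rewrite -(conjgKV h k); apply: wild_kernelJ.
  by apply: wild_kernelJ; rewrite ?groupV.
apply/pgroupP => q pr_q /(primeP q pr_q) charq.
by rewrite -(pcharf_eq charl).
Qed.

(** For a uniformizer x of E the map theta, sending g to the residue of g x /
    x, is a morphism from the inertia group N to the units of L'. If theta g =
    1 then g is wild, because every element of E is a power of x times a unit,
    so theta is injective and N is cyclic. Its generator t is mapped to a
    primitive root of unity, which comes from K and is thus fixed by G; as
    another uniformizer gives the same theta, t and its conjugates have the
    same image, and t is central. *)
Lemma residue_kernel_cyclic w : no_wild_subgroup -> discrete w ->
    (forall g, g \in G -> spec_unit (act g w / w)) ->
    (forall m z, m.-primitive_root z -> exists c, z = iota' c) ->
    (exists x, [/\ E x, x != 0 & R x 0]) ->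
  exists t, [/\ t \in 'Z(G)%g, forall g, residue_kernel g <-> g \in <[t]>%g
    & exists c : K, #[t]%g.-primitive_root c].
Proof.
move=> no_wild dw act_w rootsK /(spec_uniformizer dw)[x [Ex nzx Rx0 xP]].
have [nzw Rw0 wP] := dw.
have unit_div g v : g \in G -> v != 0 -> spec_unit (act g v / v).
  move=> Gg nzv; have [k [u [-> unit_u]]] := wP v nzv.
  rewrite (field_actM actP) // act_rmorphXz // -mulf_div invr_expz -exprz_inv -expfzMl.
  apply: spec_unitM; first exact/spec_unitXz/act_w.
  by apply: spec_unitM; [apply: spec_unit_act | apply: spec_unitV].
pose theta g := epsilon (inhabits (0 : L')) (fun y => R (act g x / x) y).
have thetaP g : g \in G -> R (act g x / x) (theta g).
  move=> Gg; apply: (epsilon_spec _ (fun y => R (act g x / x) y)).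
  by have [y Ry _] := unit_div g x Gg nzx; exists y.
have Egx g : g \in G -> E (act g x / x).
  by move=> Gg; apply: subfieldM => //; [apply: stE | apply: subfieldV].
have theta_eq1 g : residue_kernel g -> theta g = 1 -> g = 1%g.
  move=> kg theta1; apply: wild_kernel_trivial => //; split=> // b Eb nzb.
  have [Gg _] := kg; have [j [u [def_b unit_u]]] := xP b Eb nzb.
  have Eu : E u.
    have -> : u = x ^ (- j) * b by rewrite def_b mulrA -expfzDr // addNr mul1r.
    by apply: subfieldM => //; apply: subfieldXz.
  rewrite def_b (field_actM actP) // act_rmorphXz // -mulf_div.
  rewrite invr_expz -exprz_inv -expfzMl.
  have -> : 1 = 1 ^ j * 1 :> L' by rewrite exp1rz mulr1.
  apply: (specM RP); last exact: residue_kernel_unit.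
  by apply: specXz => //; [rewrite -theta1; apply: thetaP | apply: oner_neq0].
have thetaM g h : residue_kernel g -> residue_kernel h ->
    theta (g * h)%g = theta g * theta h.
  move=> [Gg kg] [Gh kh]; apply: (spec_uniq RP (thetaP _ (groupM Gg Gh))).
  have -> : act (g * h)%g x / x = act g x / x * act g (act h x / x).
    rewrite act_rmorph_div // (field_act_comp actP) // [RHS]mulrC mulrA divfK //.
    by rewrite act_eq0.
  by apply: (specM RP); [apply: thetaP | apply: kg; [apply: Egx | apply: thetaP]].
pose N := [set h | decide (residue_kernel h)].
have inN h : reflect (residue_kernel h) (h \in N).
  by rewrite inE; apply: decideP.
have gN : group_set N.
  apply/group_setP; split=> [|h k /inN wh /inN wk]; apply/inN.
    exact: residue_kernel1.
  exact: residue_kernelM.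
have theta1 : theta 1%g = 1.
  apply: (spec_uniq RP (thetaP _ (group1 G))).
  by rewrite (field_act_id actP) divff //; apply: spec_one.
have theta_inj g h : residue_kernel g -> residue_kernel h ->
    theta g = theta h -> g = h.
  move=> kg kh eq_gh; apply/eqP; rewrite eq_mulgV1; apply/eqP.
  have kh' : residue_kernel h^-1%g by apply/inN/(groupVr (G := Group gN))/inN.
  apply: theta_eq1; first exact: residue_kernelM.
  by rewrite thetaM // eq_gh -thetaM // mulgV.
have /cyclicP[t defN] : cyclic (Group gN).
  apply: (field_mul_group_cyclic (f := theta)).
    by move=> g h /inN kg /inN kh; apply: thetaM.
  move=> g /inN kg; split=> [|->]; [exact: theta_eq1 | exact: theta1].
have kt : residue_kernel t by apply/inN; rewrite [N]defN cycle_id.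
have [Gt _] := kt.
have kti i : residue_kernel (t ^+ i)%g.
  by apply/inN; rewrite [N]defN mem_cycle.
have thetaX i : theta (t ^+ i)%g = theta t ^+ i.
  by elim: i => // i IHi; rewrite expgS thetaM // IHi exprS.
have prim_t : #[t]%g.-primitive_root (theta t).
  rewrite /primitive_root_of_unity order_gt0; apply/forallP => i.
  rewrite unity_rootE -thetaX -theta1; apply/eqP.
  have -> : (theta (t ^+ i.+1)%g == theta 1%g) = (#[t]%g %| i.+1)%N.
    rewrite order_dvdn; apply/eqP/eqP => [|->//]; apply: theta_inj => //.
    exact: residue_kernel1.
  apply/idP/eqP => [dvdti|->//]; apply/eqP; rewrite eqn_leq ltn_ord.
  exact: dvdn_leq dvdti.
have [c def_c] := rootsK _ _ prim_t.
exists t; split; last 1 first.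
- by exists c; rewrite -(fmorph_primitive_root iota') -def_c.
- apply/centerP; split=> // g Gg; apply/commgP/conjg_fixP/theta_inj => //.
    exact: residue_kernelJ.
  have Gtg : (t ^ g)%g \in G by apply: groupJ.
  apply: (spec_uniq RP (thetaP _ Gtg)) => //.
  have Gg' := groupVr Gg; have nzgx : act g x != 0 by rewrite act_eq0.
  rewrite conjgE !(field_act_comp actP) ?groupM // -{2}(actVK actP x Gg).
  rewrite -act_rmorph_div // def_c -(act'_ground c Gg') -def_c.
  apply: Ract => //; rewrite -[act g x](divfK nzx) (field_actM actP) // -mulf_div.
  rewrite -[theta t]mul1r; apply: (specM RP); last exact: thetaP.
  by apply: residue_kernel_unit => //; [apply: Egx | apply: unit_div].
- move=> g; rewrite -defN; split=> [kg|/inN//]; exact/inN.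
Qed.

End ResidueAction.

(** * The action on rational functions *)

Section RationalFunctionAction.
Variables (K : fieldType) (n : nat) (gT : finGroupType) (G : {group gT}).
Variable rG : mx_representation K G n.
Local Notation tofrac := (@FracField.tofrac {mpoly K[n]}).

Lemma ratfunP (f : ratfun K n) : exists a b, b != 0 /\ f = tofrac a / tofrac b.
Proof.
by do 2!eexists; split; [apply: denom_ratioP | apply: fraction_repr].
Qed.

Lemma poly_actX g i : poly_act rG g 'X_i = \sum_j rG g^-1%g i j *: 'X_j.
Proof. by rewrite /poly_act comp_mpolyXU -tnth_nth tnth_mktuple. Qed.

Lemma poly_actC g c : poly_act rG g c%:MP = c%:MP.
Proof. exact: comp_mpolyC. Qed.

Lemma poly_act1 p : poly_act rG 1%g p = p.
Proof.
move: p; apply: (@mpoly_rmorph_eq K _ n (comp_mpoly _) idfun) => [c|i] /=.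
  exact: comp_mpolyC.
rewrite -[LHS]/(poly_act rG 1%g 'X_i) poly_actX invg1 repr_mx1.
rewrite (bigD1 i) //= mxE eqxx scale1r big1 ?addr0 // => j /negPf nji.
by rewrite mxE eq_sym nji scale0r.
Qed.

Lemma poly_actM g h p : g \in G -> h \in G ->
  poly_act rG (g * h)%g p = poly_act rG g (poly_act rG h p).
Proof.
move=> Gg Gh; move: p.
apply: (@mpoly_rmorph_eq K _ n (comp_mpoly _) (comp_mpoly _ \o comp_mpoly _)).
  by move=> c; rewrite /= !comp_mpolyC.
move=> i; rewrite -[LHS]/(poly_act rG (g * h)%g 'X_i).
rewrite -[RHS]/(poly_act rG g (poly_act rG h 'X_i)) !poly_actX invMg.
rewrite repr_mxM ?groupV // /poly_act linear_sum /=.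
under [RHS]eq_bigr => j _.
  rewrite linearZ /= -[_ \mPo _]/(poly_act rG g 'X_j) poly_actX scaler_sumr.
  over.
rewrite exchange_big; apply: eq_bigr => j _ /=; rewrite mxE scaler_suml.
by apply: eq_bigr => k _; rewrite scalerA.
Qed.

Lemma poly_act_eq0 g p : g \in G -> (poly_act rG g p == 0) = (p == 0).
Proof.
move=> Gg; apply/eqP/eqP => [gp0|->]; last by rewrite /poly_act rmorph0.
by rewrite -(poly_actK rG Gg p) gp0 /poly_act rmorph0.
Qed.

Lemma ratfun_act_tofrac g p : g \in G ->
  ratfun_act rG g (tofrac p) = tofrac (poly_act rG g p).
Proof.
move=> Gg; rewrite -[tofrac p]divr1 -tofrac1 ratfun_act_div ?oner_neq0 //.
by rewrite {2}/poly_act rmorph1 tofrac1 divr1.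
Qed.

Lemma ratfun_field_action : field_action (ratfunC K n) G (ratfun_act rG).
Proof.
split=> [g Gg f f'|g Gg f f'|g Gg a|f|g h Gg Gh f].
- have [a [b [nzb ->]]] := ratfunP f; have [a' [b' [nzb' ->]]] := ratfunP f'.
  have nz_tofrac p : p != 0 -> tofrac p != 0 by rewrite tofrac_eq0.
  rewrite addf_div ?nz_tofrac // -!tofracM -tofracD.
  rewrite !ratfun_act_div ?mulf_neq0 // addf_div ?nz_tofrac ?poly_act_eq0 //.
  by rewrite /poly_act !rmorphD !rmorphM.
- have [a [b [nzb ->]]] := ratfunP f; have [a' [b' [nzb' ->]]] := ratfunP f'.
  rewrite mulf_div -!tofracM !ratfun_act_div ?mulf_neq0 // mulf_div.
  by rewrite /poly_act !rmorphM.
- by rewrite /= ratfun_act_tofrac // poly_actC.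
- have [a [b [nzb ->]]] := ratfunP f.
  rewrite (ratfun_act_div rG _ (group1 G) nzb).
 by rewrite (poly_act1 a) (poly_act1 b).
- have [a [b [nzb ->]]] := ratfunP f.
  have nzhb : poly_act rG h b != 0 by rewrite poly_act_eq0.
  rewrite (ratfun_act_div rG _ (groupM Gg Gh) nzb) (ratfun_act_div rG _ Gh nzb).
  by rewrite (ratfun_act_div rG _ Gg nzhb) (poly_actM a Gg Gh) (poly_actM b Gg Gh).
Qed.

(** The coordinate functions show the matrix of g^-1. *)
Lemma ratfun_act_faithful : mx_faithful rG ->
  act_faithful G (ratfun_act rG) (fun _ => True).
Proof.
move=> /subsetP faithG g Gg fix_g; apply/eqP; rewrite -invg_eq1 -in_set1.
apply: faithG; rewrite inE groupV Gg mul1mx; apply/eqP/matrixP => i k.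
have /eqP := fix_g (tofrac 'X_i) I; rewrite ratfun_act_tofrac // tofrac_eq poly_actX.
move/eqP/(congr1 (mcoeff U_(k))); rewrite linear_sum mcoeffXU /= mxE => <-.
rewrite (bigD1 k) //= mcoeffZ mcoeffXU eqxx mulr1 big1 ?addr0 // => j /negPf njk.
by rewrite mcoeffZ mcoeffXU njk mulr0.
Qed.

End RationalFunctionAction.

(** * Specialization of rational functions *)

Section PolynomialSpecialization.
Variables (K : fieldType) (n : nat) (L' : fieldType).
Variable phi : {rmorphism {mpoly K[n]} -> L'}.
Local Notation tofrac := (@FracField.tofrac {mpoly K[n]}).

(** The residue map of the localization of the polynomial ring at the kernel
    of phi. *)
Definition poly_spec (f : ratfun K n) (y : L') : Prop :=
  exists p q, [/\ phi q != 0, f = tofrac p / tofrac q & y = phi p / phi q].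

Let phi_neq0 q : phi q != 0 -> tofrac q != 0.
Proof. by rewrite tofrac_eq0; apply: contraNneq => ->; rewrite rmorph0. Qed.

Lemma poly_spec_specialization : specialization poly_spec.
Proof.
split.
- by exists 1, 1; rewrite rmorph1 tofrac1 !divr1 oner_neq0.
- move=> _ _ _ _ [p [q [nzq -> ->]]] [p' [q' [nzq' -> ->]]].
  exists (p * q' - p' * q), (q * q').
  have [nzf nzf'] := (phi_neq0 nzq, phi_neq0 nzq').
  split; first by rewrite rmorphM mulf_neq0.
    rewrite tofracB !tofracM -[in LHS]mulNr.
    rewrite (addf_div _ _ nzf nzf').
    by rewrite mulNr.
  by rewrite rmorphB !rmorphM -[in LHS]mulNr (addf_div _ _ nzq nzq') mulNr.
- move=> _ _ _ _ [p [q [nzq -> ->]]] [p' [q' [nzq' -> ->]]].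
  exists (p * p'), (q * q').
  split; first by rewrite rmorphM mulf_neq0.
    by rewrite !tofracM mulf_div.
  by rewrite !rmorphM mulf_div.
- move=> _ _ [p [q [nzq -> ->]]] nzpq; exists q, p; rewrite !invf_div; split=> //.
  by apply: contraNneq nzpq => ->; rewrite mul0r.
- move=> y [p [q [nzq /esym/eqP p0 ->]]]; move: p0.
  rewrite mulf_eq0 invr_eq0 (negPf (phi_neq0 nzq)) orbF tofrac_eq0 => /eqP->.
  by rewrite rmorph0 mul0r.
Qed.

Lemma poly_spec_tofrac p : poly_spec (tofrac p) (phi p).
Proof. by exists p, 1; rewrite rmorph1 tofrac1 !divr1 oner_neq0. Qed.

Lemma poly_spec_act (iota' : {rmorphism K -> L'}) (gT gT' : finGroupType)
    (G : {group gT}) (G' : {group gT'}) (rG : mx_representation K G n)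
    (act' : gT' -> L' -> L') g g' : field_action iota' G' act' ->
    (forall c, phi c%:MP = iota' c) ->
    g \in G -> g' \in G' ->
    (forall i, phi (poly_act rG g 'X_i) = act' g' (phi 'X_i)) ->
  forall f y, poly_spec f y -> poly_spec (ratfun_act rG g f) (act' g' y).
Proof.
move=> actP' phiC Gg Gg' phiX _ _ [p [q [nzq -> ->]]].
have phiE : phi \o poly_act rG g =1 act' g' \o phi.
  rewrite (actE actP' Gg'); apply: (@mpoly_rmorph_eq K _ n
    (phi \o comp_mpoly _) (act_rmorph act' Gg' \o phi)).
    move=> c; rewrite /= comp_mpolyC phiC.
    by rewrite /act_rmorph (field_act_ground actP').
  exact: phiX.
have {}phiE r : phi (poly_act rG g r) = act' g' (phi r) by apply: phiE.
have nzgq : phi (poly_act rG g q) != 0.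
  by rewrite phiE (actE actP' Gg') fmorph_eq0.
exists (poly_act rG g p), (poly_act rG g q); split; first exact: nzgq.
  apply: (ratfun_act_div rG) => //.
  by apply: contraNneq nzq => ->; rewrite rmorph0.
by rewrite !phiE (actE actP' Gg') fmorph_div.
Qed.

End PolynomialSpecialization.

(** Write z = p / q, so that p^m = q^m. Then p and q have the same leading
    monomial, and scaling q by a constant c gives r with p^m = r^m and the
    same leading term as p. If p differs from r then the sum of the p^(m-1-i)
    r^i is 0, but its leading coefficient is m times a nonzero constant, and m
    is invertible since z has order m. *)
Lemma ratfun_root_of_unity (K : fieldType) n m (z : ratfun K n) :
  m.-primitive_root z -> exists c, z = ratfunC K n c.
Proof.
move=> prim_z; have [p [q [nzq def_z]]] := ratfunP z.
set tofrac := @FracField.tofrac {mpoly K[n]} in def_z.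
have m_gt0 := prim_order_gt0 prim_z.
have nzq' : tofrac q != 0 by rewrite tofrac_eq0.
have nzmK : m%:R != 0 :> K.
  have := prim_root_natf_neq0 prim_z.
  by rewrite -(rmorph_nat (ratfunC K n)) fmorph_eq0.
have eq_pq : p ^+ m = q ^+ m.
  apply/eqP; rewrite -tofrac_eq !tofracXn -/tofrac.
  have -> : tofrac p = z * tofrac q by rewrite def_z divfK.
  by rewrite exprMn prim_expr_order // mul1r.
have nzp : p != 0.
  by have := expf_neq0 m nzq; rewrite -eq_pq expf_eq0 m_gt0.
have lead_pq : mlead p = mlead q.
  have /(congr1 (@mlead _ _)) := eq_pq; rewrite !mleadX // => /mnmP eq_lead.
  apply/mnmP => i; have := eq_lead i; rewrite !mulmnE => /eqP.
  by rewrite eqn_pmul2r // => /eqP.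
pose c := mleadc p / mleadc q; pose r := c *: q.
have nz_lead (s : {mpoly K[n]}) : s != 0 -> mleadc s != 0 by rewrite mleadc_eq0.
have nzc : c != 0 by rewrite mulf_neq0 ?invr_eq0 ?nz_lead.
have nzr : r != 0 by rewrite scaler_eq0 negb_or nzc.
have lead_r : mlead r = mlead p by rewrite mleadZ // lead_pq.
have leadc_r : mleadc r = mleadc p by rewrite mleadcZE divfK ?nz_lead.
have rm : p ^+ m = r ^+ m.
  rewrite exprZn eq_pq; have /(congr1 (fun s => mleadc s)) := eq_pq.
  rewrite !mleadX // !mleadcX expr_div_n => ->.
  by rewrite divff ?scale1r ?expf_neq0 ?nz_lead.
suff eq_pr : p = r.
  exists c; rewrite def_z eq_pr /r -mul_mpolyC /tofrac tofracM -mulrA divff //.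
  by rewrite mulr1.
have /eqP := rm; rewrite -subr_eq0 subrXX mulf_eq0 subr_eq0 => /orP[/eqP//|].
set S := \sum_(i < m) _ => /eqP S0; case/eqP: nzmK.
have term i : (i < m)%N ->
    (p ^+ (m.-1 - i) * r ^+ i)@_(mlead p *+ m.-1) = mleadc p ^+ m.-1.
  move=> ltim; have le_i : (i <= m.-1)%N by rewrite -ltnS prednK.
  have -> : (mlead p *+ m.-1 = mlead p *+ (m.-1 - i) + mlead r *+ i)%MM.
    apply/mnmP => k; rewrite mnmDE !mulmnE lead_r -mulnDr subnK //.
  rewrite mleadcMW ?mleadX_le // !mleadcX leadc_r -exprD subnK //.
have := congr1 (mcoeff (mlead p *+ m.-1)) S0; rewrite mcoeff0 linear_sum /=.
under eq_bigr => i _ do rewrite term //.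
rewrite sumr_const card_ord -[X in X = _ -> _]mulr_natr => /eqP.
by rewrite mulf_eq0 (negPf (expf_neq0 _ (nz_lead p nzp))) => /eqP.
Qed.

(** * Generic equivariant vectors *)

Section Nonvanishing.
Variables (K L : fieldType) (iota : {rmorphism K -> L}).

Definition infinite_subset (S : L -> Prop) : Prop :=
  exists2 u : nat -> L, injective u & forall i, S (u i).

Lemma poly_nonvanishing S (p : {poly L}) : infinite_subset S -> p != 0 ->
  exists2 a, S a & p.[a] != 0.
Proof.
case=> u inj_u Su nzp; apply: NNPP => no_a.
have /(max_poly_roots nzp) : all (root p) (mkseq u (size p)).
  apply/allP => _ /mapP[i _ ->]; apply: contraT => pui.
  by case: no_a; exists (u i).
by rewrite mkseq_uniq // size_mkseq ltnn => /(_ isT).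
Qed.

Lemma eq_mmap n (v v' : 'I_n -> L) : v =1 v' ->
  (mmap iota v : {mpoly K[n]} -> L) =1 mmap iota v'.
Proof.
move=> eq_v; apply: mpoly_rmorph_eq => [c|i] /=; first by rewrite !mmapC.
by rewrite !mmapX !mmap1U.
Qed.

Lemma mpoly_nonvanishing n S (f : {mpoly K[n]}) : infinite_subset S -> f != 0 ->
  exists2 v : 'I_n -> L, forall i, S (v i) & mmap iota v f != 0.
Proof.
move=> infS; elim: n f => [|n IHn] f nzf.
  exists (fun _ => 0) => [[]//|].
  rewrite [f]nvar0_mpolyC mmapC fmorph_eq0; apply: contraNneq nzf => f0.
  by rewrite [f]nvar0_mpolyC f0 mpolyC0.
have [i nzfi] : exists i, (muni f)`_i != 0.
  exists (size (muni f)).-1; rewrite -[_`_ _]/(lead_coef _) lead_coef_eq0.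
  by apply: contraNneq nzf => f0; rewrite -[f]mpoly_expand_last f0 rmorph0 horner0.
have [v Sv nzv] := IHn _ nzfi.
have [|a Sa nza] := @poly_nonvanishing S (map_poly (mmap iota v) (muni f)) infS.
  by apply: contraNneq nzv => fv0; rewrite -coef_map fv0 coef0.
pose t i := if unlift ord_max i is Some j then v j else a.
exists t => [j|]; first by rewrite /t; case: unlift.
have tv j : t (widen_ord (leqnSn n) j) = v j.
  have -> : widen_ord (leqnSn n) j = lift ord_max j by apply/val_inj/esym/lift_max.
  by rewrite /t liftK.
rewrite mmap_expand_last /t unlift_none.
by rewrite (eq_map_poly (g := mmap iota v)) // => r; apply: eq_mmap.
Qed.

End Nonvanishing.

(** The coordinates s x are moved into S one at a time: as a function of one
    of them, the value of f is a nonzero polynomial in one variable, which has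
    a non-root in the infinite set S. *)
Lemma coordinatewise_nonvanishing (K L : fieldType) (iota : {rmorphism K -> L})
    (I : finType) n S (f : {mpoly K[n]}) (C : I -> 'I_n -> L) (s : I -> L) :
    infinite_subset S -> mmap iota (fun i => \sum_x s x * C x i) f != 0 ->
  exists2 s' : I -> L, forall x, S (s' x) &
    mmap iota (fun i => \sum_x s' x * C x i) f != 0.
Proof.
move=> infS nzs.
suff step (r : seq I) : exists2 s' : I -> L, forall x, x \in r -> S (s' x) &
    mmap iota (fun i => \sum_x s' x * C x i) f != 0.
  have [s' Ss' nzs'] := step (enum I).
  by exists s' => // x; apply: Ss'; rewrite mem_enum.
elim: r => [|y r [s' Ss' nzs']]; first by exists s.
pose w i := \sum_(x | x != y) s' x * C x i.
pose p := mmap (polyC \o iota) (fun i => (w i)%:P + (C y i)%:P * 'X) f.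
have pE a : p.[a] = mmap iota (fun i => w i + a * C y i) f.
  apply: (@mpoly_rmorph_eq K L n (horner_eval a \o mmap (polyC \o iota) _)).
    by move=> c; rewrite /= !mmapC /horner_eval hornerC.
  by move=> i; rewrite /= !mmapX !mmap1U /horner_eval !hornerE mulrC.
have [|a Sa nzpa] := @poly_nonvanishing _ S p infS.
  apply: contraNneq nzs' => p0; apply/eqP.
  transitivity p.[s' y]; last by rewrite p0 horner0.
  by rewrite pE; apply: eq_mmap => i; rewrite (bigD1 y) //= addrC.
exists (fun x => if x == y then a else s' x) => [x|].
  by rewrite inE; case: eqP => //= _; apply: Ss'.
apply: contraNneq nzpa => sum0; rewrite pE; apply/eqP; rewrite -[RHS]sum0.
apply: eq_mmap => i; rewrite [RHS](bigD1 y) //= eqxx addrC; congr (_ + _).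
by apply: eq_bigr => x /negPf->.
Qed.

(** Combinations of the averages C with coefficients in the fixed field are
    equivariant. Over L these averages span all vectors, because the matrix of
    conjugates of b is invertible, so f does not vanish at some combination
    with coefficients in L; the coefficients can then be moved into the fixed
    field. *)
Lemma equivariant_nonvanishing (K L : fieldType) (iota : {rmorphism K -> L})
    (gT : finGroupType) (G : {group gT}) (act : gT -> L -> L) n
    (rG : mx_representation K G n) (f : {mpoly K[n]}) :
    field_action iota G act -> act_faithful G act (fun _ => True) ->
    infinite_subset (act_fixed G act) -> f != 0 ->
  exists2 c : 'I_n -> L, forall g, g \in G -> forall i,
      act g (c i) = \sum_j iota (rG g^-1%g i j) * c j & mmap iota c f != 0.
Proof.
move=> actP faithL infF nzf.
have sfL : subfield (fun _ : L => True) by [].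
have infL : infinite_subset (fun _ : L => True) by have [u] := infF; exists u.
have [v _ nzv] := mpoly_nonvanishing iota infL nzf.
have [b [_ unitB]] := act_matrix_free actP sfL faithL (fun _ _ _ _ => I).
set B := \matrix_(i, j) _ in unitB.
(* The coefficients a extract the identity from the conjugates of b. *)
pose a := (\row_j (@enum_val _ (mem G) j == 1%g)%:R : 'rV[L]_#|G|) *m invmx B.
have aE h : h \in G -> \sum_k a 0 k * act h (b k) = (h == 1%g)%:R.
  have aB : a *m B = \row_j (@enum_val _ (mem G) j == 1%g)%:R.
    by rewrite /a mulmxKV.
  move=> Gh; have /rowP/(_ (enum_rank_in Gh h)) := aB.
  rewrite !mxE enum_rankK_in // => <-.
  by apply: eq_bigr => k _; rewrite !mxE enum_rankK_in.
pose C (x : 'I_#|G| * 'I_n) i := \sum_(h in G) iota (rG h i x.2) * act h (b x.1).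
have [s' Fs' nzs'] : exists2 s' : 'I_#|G| * 'I_n -> L,
    forall x, act_fixed G act (s' x) &
    mmap iota (fun i => \sum_x s' x * C x i) f != 0.
  apply: (coordinatewise_nonvanishing (s := fun x => a 0 x.1 * v x.2)) => //.
  apply: contraNneq nzv => <-; apply/eqP/eq_mmap => i.
  rewrite -(pair_bigA _ (fun k j => a 0 k * v j * C (k, j) i)) /= exchange_big /=.
  have CE j : \sum_k a 0 k * v j * C (k, j) i = v j * (i == j)%:R.
    rewrite /C /=; under eq_bigr => k _ do rewrite mulr_sumr.
    have hE h : h \in G -> \sum_k a 0 k * v j * (iota (rG h i j) * act h (b k)) =
        v j * iota (rG h i j) * (h == 1%g)%:R.
      move=> Gh; rewrite -aE // mulr_sumr; apply: eq_bigr => k _.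
      by rewrite -mulrA mulrCA -!mulrA; congr (_ * _); rewrite mulrCA.
    rewrite exchange_big (bigD1 1%g) //= hE // eqxx mulr1 repr_mx1 mxE.
    rewrite rmorph_nat big1 ?addr0 // => h /andP[Gh /negPf nth].
    by rewrite hE // nth mulr0.
  under [RHS]eq_bigr => j _ do rewrite CE.
  rewrite (bigD1 i) //= eqxx mulr1 big1 ?addr0 // => j /negPf nji.
  by rewrite eq_sym nji mulr0.
exists (fun i => \sum_x s' x * C x i) => // g Gg i.
rewrite (act_sum actP Gg).
under [RHS]eq_bigr => j _ do rewrite mulr_sumr.
rewrite exchange_big; apply: eq_bigr => -[k j] _ /=.
rewrite (field_actM actP Gg) Fs' //.
under [RHS]eq_bigr => l _ do rewrite mulrCA.
rewrite -mulr_sumr; congr (_ * _); rewrite /C /=.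
rewrite (act_sum actP Gg) (reindex_inj (mulgI g^-1%g)) /=.
under eq_bigl => h do rewrite groupMl ?groupV //.
under [RHS]eq_bigr => l _ do rewrite mulr_sumr.
rewrite exchange_big; apply: eq_bigr => h Gh /=.
rewrite (field_actM actP Gg) (field_act_ground actP) //.
rewrite -(field_act_comp actP) ?groupM ?groupV // mulKVg repr_mxM ?groupV //.
rewrite mxE rmorph_sum mulr_suml; apply: eq_bigr => l _.
by rewrite rmorphM mulrA.
Qed.

(** The product Y of the conjugates of a variable is invariant and vanishes at
    the origin, so no positive power of it is 1, and its powers are distinct. *)
Lemma ratfun_fixed_infinite (K : fieldType) n (gT : finGroupType)
    (G : {group gT}) (rG : mx_representation K G n) : (0 < n)%N ->
  infinite_subset (act_fixed G (ratfun_act rG)).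
Proof.
case: n rG => // n rG _; have actP := ratfun_field_action rG.
set tofrac := @FracField.tofrac {mpoly K[n.+1]}.
pose Y : {mpoly K[n.+1]} := \prod_(g in G) poly_act rG g 'X_ord0.
have nzY : Y != 0.
  by apply/prodf_neq0 => g Gg; rewrite poly_act_eq0 // -msupp_eq0 msuppX.
have Y0 : meval (fun _ => 0) Y = 0.
  by rewrite /Y (bigD1 1%g) //= poly_act1 rmorphM /= mevalXU mul0r.
have fixY : act_fixed G (ratfun_act rG) (tofrac Y).
  move=> g Gg; rewrite ratfun_act_tofrac //; congr tofrac.
  rewrite /Y /poly_act rmorph_prod (reindex_inj (mulgI g^-1%g)) /=.
  apply: eq_big => [h|h Gh]; first by rewrite groupMl ?groupV.
  have Gh' : h \in G by move: Gh; rewrite groupMl ?groupV.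
  rewrite -/(poly_act rG g _) -/(poly_act rG (g^-1 * h)%g _) -poly_actM //.
  by rewrite mulKVg.
exists (fun i => tofrac Y ^+ i) => [i j eq_ij|i].
  wlog: i j eq_ij / (i <= j)%N => [IH|leij].
    by case/orP: (leq_total i j) => [/IH->|/IH->].
  apply/eqP; rewrite eqn_leq leij /= -subn_eq0; apply: contraT.
  rewrite -lt0n => lt0m; have Y1 : Y ^+ (j - i) = 1.
    apply: (mulfI (expf_neq0 i nzY)); rewrite mulr1 -exprD subnKC //.
    by apply/eqP; rewrite -tofrac_eq !tofracXn; apply/eqP/esym.
  have := congr1 (meval (fun _ => 0)) Y1; rewrite rmorphXn rmorph1 /= Y0 expr0n.
  by rewrite eqn0Ngt lt0m => /esym/eqP; rewrite oner_eq0.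
exact: (subfieldX (act_fixed_subfield actP)).
Qed.

(** * Transfer of compressions along specializations *)

Section CompressionTransfer.
Variables (K L L' : fieldType) (iota : {rmorphism K -> L}).
Variables (iota' : {rmorphism K -> L'}) (gT gT' : finGroupType).
Variables (G : {group gT}) (G' : {group gT'}) (f : gT -> gT').
Variables (act : gT -> L -> L) (act' : gT' -> L' -> L') (R : L -> L' -> Prop).
Hypotheses (RP : specialization R) (Rground : forall a, R (iota a) (iota' a)).
Hypothesis f_onto : forall g', g' \in G' -> exists2 g, g \in G & f g = g'.
Hypothesis Ract : forall g, g \in G ->
  forall x y, R x y -> R (act g x) (act' (f g) y).

Lemma ground_field_total : spec_total R (ground_field iota).
Proof. by move=> _ [a ->]; exists (iota' a). Qed.

Lemma residue_ground_field :
  subpred_of (residue R (ground_field iota)) (ground_field iota').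
Proof.
by move=> y [_ [[a ->] Ray]]; exists a; apply: (spec_uniq RP Ray).
Qed.

Lemma residue_compressible E d : subfield E ->
    subpred_of (ground_field iota) E -> act_stable G act E ->
    (forall g, g \in G -> (forall x y, E x -> R x y -> act' (f g) y = y) ->
       f g = 1%g) ->
    trdeg_le (ground_field iota') (residue R E) d ->
  compressible iota' G' act' d.
Proof.
move=> sfE KE stE faithE trE; exists (residue R E); split=> //.
- exact: residue_subfield.
- by move=> _ [a ->]; exists (iota a); split=> //; apply: KE; exists a.
- move=> _ /f_onto[g Gg <-] y [x [Ex Rxy]].
  by exists (act g x); split; [apply: stE | apply: Ract].
- move=> _ /f_onto[g Gg <-] fix_g; apply: faithE => // x y Ex Rxy.
  by apply: fix_g; exists x.
Qed.

End CompressionTransfer.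

Section ChangeOfRepresentation.
Variables (K : fieldType) (gT : finGroupType) (G : {group gT}).

(** The field of constants is a compression. *)
Lemma compressible_trivial_group n (rG : mx_representation K G n) d :
  G :=: 1%g -> compressible (ratfunC K n) G (ratfun_act rG) d.
Proof.
move=> G1; have sfK := ground_field_subfield (ratfunC K n).
exists (ground_field (ratfunC K n)); split=> //.
- move=> g Gg _ [a ->]; exists a.
  exact: (field_act_ground (ratfun_field_action rG)).
- by move=> g; rewrite G1 => /set1P.
- move=> [|x s] // Ks [[]]; apply: algebraic_over_base => //.
  by apply: Ks; rewrite mem_head.
Qed.

(** Each nontrivial g moves some x in E. A specialization at a generic
    equivariant vector is defined at x and at g x - x, and gives the latter a
    nonzero residue, so that G remains faithful on the residues of E. *)
Lemma compressible_change_rep m n (rG : mx_representation K G m)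
    (rG' : mx_representation K G n) d : mx_faithful rG' ->
  compressible (ratfunC K m) G (ratfun_act rG) d ->
  compressible (ratfunC K n) G (ratfun_act rG') d.
Proof.
move=> faith_rG'; case: n => [|n] in rG' faith_rG' *.
  move=> _; apply: compressible_trivial_group; apply/trivgP.
  apply: subset_trans faith_rG'; apply/subsetP => g Gg.
  by rewrite inE Gg; apply/eqP/matrixP => -[].
have [actP actP'] := (ratfun_field_action rG, ratfun_field_action rG').
set act := ratfun_act rG in actP *; set act' := ratfun_act rG' in actP' *.
set tofrac := @FracField.tofrac {mpoly K[m]}.
case=> E [sfE KE stE faithE trE].
pose pairs := ({mpoly K[m]} * {mpoly K[m]} * ({mpoly K[m]} * {mpoly K[m]}))%type.
have moved g : exists h : pairs,
    [/\ h.1.1 != 0, h.1.2 != 0, h.2.2 != 0 & g \in G -> g != 1%g ->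
      let x := tofrac h.2.1 / tofrac h.2.2 in
      E x /\ act g x - x = tofrac h.1.1 / tofrac h.1.2].
  have [Gg|] := boolP (g \in G); last first.
    by exists ((1, 1), (1, 1)); rewrite oner_neq0.
  have [->|/eqP ntg] := eqVneq g 1%g.
    by exists ((1, 1), (1, 1)); rewrite oner_neq0.
  have [x [Ex gx]] : exists x, E x /\ act g x <> x.
    apply: NNPP => /not_ex_all_not no_x; apply/ntg/faithE => // x Ex.
    by have /not_and_or[//|/NNPP] := no_x x.
  have [a [b [nzb def_x]]] := ratfunP x.
  have [p [q [nzq def_gx]]] := ratfunP (act g x - x).
  exists ((p, q), (a, b)); split=> //=; last by rewrite -def_x -def_gx.
  apply: contra_not_neq gx => p0; apply/eqP; rewrite -subr_eq0 def_gx p0.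
  by rewrite tofrac0 mul0r.
have [h hP] := @fin_all_exists _ _ _ moved.
(* The vector has to avoid the zeros of all numerators and denominators in
   play. *)
pose F := \prod_g ((h g).1.1 * (h g).1.2 * (h g).2.2).
have nzF : F != 0.
  by apply/prodf_neq0 => g _; have [? ? ? _] := hP g; rewrite !mulf_neq0.
have infF := @ratfun_fixed_infinite K n.+1 gT G rG' isT.
have [c act_c nzFc] := equivariant_nonvanishing rG actP'
  (ratfun_act_faithful faith_rG') infF nzF.
pose phi : {rmorphism {mpoly K[m]} -> ratfun K n.+1} := mmap (ratfunC K n.+1) c.
have phiC a : phi a%:MP = ratfunC K n.+1 a by apply: mmapC.
have phi_neq0 g :
    [/\ phi (h g).1.1 != 0, phi (h g).1.2 != 0 & phi (h g).2.2 != 0].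
  have : phi F != 0 by [].
  rewrite /F rmorph_prod => /prodf_neq0/(_ g isT); rewrite !rmorphM !mulf_eq0.
  rewrite !negb_or => /andP[/andP[nz1 nz2] nz3].
  split; [exact: nz1 | exact: nz2 | exact: nz3].
have RP := poly_spec_specialization phi.
have Rground a : poly_spec phi (ratfunC K m a) (ratfunC K n.+1 a).
  by rewrite -phiC; apply: poly_spec_tofrac.
have Ract g : g \in G ->
    forall x y, poly_spec phi x y -> poly_spec phi (act g x) (act' g y).
  move=> Gg; apply: (poly_spec_act actP' phiC Gg Gg) => i.
  rewrite poly_actX rmorph_sum [phi 'X_i]mmapX mmap1U act_c //.
  apply: eq_bigr => j _; rewrite -mul_mpolyC rmorphM phiC; congr (_ * _).
  by rewrite [LHS]mmapX mmap1U.
apply: (residue_compressible (f := id) RP Rground _ Ract sfE KE stE).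
- by move=> g Gg; exists g.
- move=> g Gg fix_g; apply/eqP/negPn/negP => ntg.
  have [_ _ _ /(_ Gg ntg)[]] := hP g.
  have [nz1 nz2 nz3] := phi_neq0 g; set x := _ / _ => Ex def_gx.
  have Rx : poly_spec phi x (phi (h g).2.1 / phi (h g).2.2).
    by exists (h g).2.1, (h g).2.2.
  have := specB RP (Ract g Gg _ _ Rx) Rx; rewrite (fix_g _ _ Ex Rx) subrr def_gx.
  have R1 : poly_spec phi (tofrac (h g).1.1 / tofrac (h g).1.2)
      (phi (h g).1.1 / phi (h g).1.2).
    by exists (h g).1.1, (h g).1.2.
  move/(spec_uniq RP R1)/eqP; rewrite mulf_eq0 invr_eq0.
  by rewrite (negPf nz1) (negPf nz2).
- apply: residue_trdeg_le trE => //.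
  + exact: ground_field_subfield.
  + exact: ground_field_total Rground.
  + exact: residue_ground_field RP Rground.
Qed.

End ChangeOfRepresentation.

(** * Splitting off a one-dimensional representation *)

Section FirstVariable.
Variables (K : fieldType) (n : nat).
Local Notation X0 := ('X_(lshift n (0 : 'I_1)) : {mpoly K[1 + n]}).

(** The inclusion of K[x_1, ..., x_n] in K[x_0, ..., x_n]. *)
Definition mpoly_shift : {mpoly K[n]} -> {mpoly K[1 + n]} :=
  mmap (@mpolyC (1 + n) K) (fun i => 'X_(rshift 1 i)).
HB.instance Definition _ := GRing.RMorphism.on mpoly_shift.

(** The substitution x_0 = 0. *)
Definition mpoly_at0 : {mpoly K[1 + n]} -> {mpoly K[n]} :=
  mmap (@mpolyC n K) (fun i => if split i is inr j then 'X_j else 0).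
HB.instance Definition _ := GRing.RMorphism.on mpoly_at0.

Lemma mpoly_shiftC c : mpoly_shift c%:MP = c%:MP. Proof. exact: mmapC. Qed.
Lemma mpoly_shiftX i : mpoly_shift 'X_i = 'X_(rshift 1 i).
Proof. by rewrite /mpoly_shift mmapX mmap1U. Qed.
Lemma mpoly_at0C c : mpoly_at0 c%:MP = c%:MP. Proof. exact: mmapC. Qed.
Lemma mpoly_at0X0 : mpoly_at0 X0 = 0.
Proof. by rewrite /mpoly_at0 mmapX mmap1U (unsplitK (inl _)). Qed.
Lemma mpoly_at0X i : mpoly_at0 'X_(rshift 1 i) = 'X_i.
Proof. by rewrite /mpoly_at0 mmapX mmap1U (unsplitK (inr _)). Qed.

Lemma mpoly_shiftK : cancel mpoly_shift mpoly_at0.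
Proof.
apply: (@mpoly_rmorph_eq K _ n (mpoly_at0 \o mpoly_shift) idfun) => [c|i] /=.
  by rewrite mpoly_shiftC mpoly_at0C.
by rewrite mpoly_shiftX mpoly_at0X.
Qed.

Lemma mpoly_div_first (p : {mpoly K[1 + n]}) :
  exists q, p = X0 * q + mpoly_shift (mpoly_at0 p).
Proof.
pose P r := exists q, r = X0 * q + mpoly_shift (mpoly_at0 r).
have PD r s : P r -> P s -> P (r + s).
  move=> [q defr] [q' defs]; exists (q + q').
  by rewrite {1}defr {1}defs !rmorphD mulrDr addrACA.
have PM r s : P r -> P s -> P (r * s).
  move=> [q defr] [q' defs].
  exists (q * s + mpoly_shift (mpoly_at0 r) * q').
  rewrite !rmorphM; set R := mpoly_shift _ in defr *.
  set S := mpoly_shift _ in defs *.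
  rewrite {1}defr mulrDl mulrDr -addrA; congr (_ + _); first by rewrite mulrA.
  by rewrite {1}defs mulrDr mulrCA.
have PC c : P c%:MP by exists 0; rewrite mpoly_at0C mpoly_shiftC mulr0 add0r.
have PX i : P 'X_i.
  case: (split_ordP i) => j ->.
    rewrite [j]ord1; exists 1.
    by rewrite /P mpoly_at0X0 rmorph0 addr0 mulr1.
  by exists 0; rewrite mpoly_at0X mpoly_shiftX mulr0 add0r.
rewrite -/(P p) [p]mpolyE; apply: big_ind => [||m _]; [exact: (PC 0)|exact: PD|].
rewrite -mul_mpolyC mpolyXE_id; apply: (PM _ _); first exact: PC.
apply: big_ind => [||i _]; [exact: (PC 1) | exact: PM |].
elim: (m i) => [|k IHk]; first exact: (PC 1).
rewrite exprS; exact: (PM _ _ (PX i) IHk).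
Qed.

Lemma mpoly_first_order (p : {mpoly K[1 + n]}) : p != 0 ->
  exists k q, p = X0 ^+ k * q /\ mpoly_at0 q != 0.
Proof.
have [m] := ubnP (msize p); elim: m p => // m IHm p ltpm nzp.
have [p0|nzp0] := eqVneq (mpoly_at0 p) 0; last by exists 0%N, p; rewrite mul1r.
have [q] := mpoly_div_first p; rewrite p0 rmorph0 addr0 => def_p.
have nzq : q != 0 by apply: contraNneq nzp => q0; rewrite def_p q0 mulr0.
have nzX : X0 != 0 by rewrite -msupp_eq0 msuppX.
have [|k [r [def_q nzr]]] := IHm q _ nzq.
  move: ltpm; rewrite def_p msizeM // msizeX mdeg1.
  by rewrite addSn /= ltnS add1n.
by exists k.+1, r; rewrite exprS -mulrA -def_q.
Qed.

End FirstVariable.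

Section TwistedRepresentation.
Variables (K : fieldType) (gT : finGroupType) (G H : {group gT}).
Variables (n : nat) (rW : mx_representation K (G / H)%G n) (chi : gT -> K).
Hypothesis nHG : G \subset 'N(H)%g.
Hypothesis chi_neq0 : forall x, x \in G -> chi x != 0.
Hypothesis chiM : forall x y, x \in G -> y \in G -> chi (x * y)%g = chi x * chi y.

Lemma chi1 : chi 1%g = 1.
Proof.
have nz1 := chi_neq0 (group1 G); apply: (mulfI nz1).
by rewrite -chiM ?mulg1 ?mulr1.
Qed.

Definition twisted_mx g : 'M[K]_(1 + n) :=
  block_mx (chi g)%:M 0 0 (rW (coset H g)).

Lemma twisted_mx_repr : mx_repr G twisted_mx.
Proof.
split=> [|x y Gx Gy]; rewrite /twisted_mx.
  by rewrite chi1 morph1 repr_mx1 scalar_mx_block.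
rewrite morphM ?(subsetP nHG) // repr_mxM ?mem_quotient //.
by rewrite mulmx_block !mul0mx !mulmx0 !addr0 !add0r -scalar_mxM chiM.
Qed.

Definition twisted_repr := MxRepresentation twisted_mx_repr.

Lemma twisted_repr_faithful : mx_faithful rW ->
    (forall x, x \in H -> x \in G -> chi x = 1 -> x = 1%g) ->
  mx_faithful twisted_repr.
Proof.
move=> /subsetP faithW chiH; apply/subsetP => x; rewrite inE mul1mx.
case/andP=> Gx /eqP; rewrite /= /twisted_mx [RHS]scalar_mx_block.
case/eq_block_mx => chix _ _ rWx; apply/set1P/chiH => //; last first.
  by move/matrixP/(_ 0 0): chix; rewrite !mxE.
apply: coset_idr; first exact: (subsetP nHG).
by apply/set1P/faithW; rewrite inE mem_quotient // mul1mx rWx eqxx.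
Qed.

Lemma twisted_act_first g :
  poly_act twisted_repr g 'X_(lshift n 0) = chi g^-1%g *: 'X_(lshift n 0).
Proof.
rewrite poly_actX big_split_ord /= big_ord1 [X in _ + X]big1 ?addr0 => [|j _].
  by rewrite block_mxEul mxE.
by rewrite block_mxEur mxE scale0r.
Qed.

Lemma twisted_act_shift g i : g \in G ->
  poly_act twisted_repr g 'X_(rshift 1 i) =
  mpoly_shift (poly_act rW (coset H g) 'X_i).
Proof.
move=> Gg; rewrite !poly_actX big_split_ord /= big_ord1 block_mxEdl mxE scale0r.
rewrite add0r rmorph_sum /=; apply: eq_bigr => j _.
rewrite block_mxEdr -morphV ?(subsetP nHG) //.
by rewrite -!mul_mpolyC rmorphM /= mpoly_shiftC mpoly_shiftX.
Qed.

End TwistedRepresentation.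

Section TwistedCompression.
Variables (K : fieldType) (gT : finGroupType) (G H : {group gT}).
Variables (n : nat) (rW : mx_representation K (G / H)%G n) (chi : gT -> K).
Hypothesis nHG : G \subset 'N(H)%g.
Hypothesis chi_neq0 : forall x, x \in G -> chi x != 0.
Hypothesis chiM : forall x y, x \in G -> y \in G -> chi (x * y)%g = chi x * chi y.
Hypothesis chiH : forall x, x \in H -> x \in G -> chi x = 1 -> x = 1%g.

Local Notation rV := (twisted_repr rW nHG chi_neq0 chiM).
Local Notation KW := (ratfun K n).
Local Notation KV := (ratfun K (1 + n)).
Local Notation tofracW := (@FracField.tofrac {mpoly K[n]}).
Local Notation tofracV := (@FracField.tofrac {mpoly K[1 + n]}).
Local Notation x0 := (tofracV 'X_(lshift n (0 : 'I_1)) : KV).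

Let actW := ratfun_field_action rW.
Let actV := ratfun_field_action rV.

Lemma ratfun_neq0_x0 : x0 != 0.
Proof. by rewrite tofrac_eq0 -msupp_eq0 msuppX. Qed.

Lemma ratfun_act_x0 g : g \in G ->
  ratfun_act rV g x0 = ratfunC K (1 + n) (chi g^-1%g) * x0.
Proof.
move=> Gg; rewrite ratfun_act_tofrac // twisted_act_first.
by rewrite -mul_mpolyC tofracM.
Qed.

Let phi1 : {rmorphism {mpoly K[n]} -> KV} :=
  (tofracV : {rmorphism _ -> _}) \o @mpoly_shift K n.

(** If E compresses the action on K(W) then E(x0) compresses the action on
    K(W)(x0): an element that fixes E lies in H, and one that fixes x0 is in
    the kernel of chi. *)
Lemma compressible_twisted d :
  compressible (ratfunC K n) (G / H)%G (ratfun_act rW) d ->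
  compressible (ratfunC K (1 + n)) G (ratfun_act rV) d.+1.
Proof.
case=> E [sfE KE stE faithE trE].
have RP := poly_spec_specialization phi1; set R := poly_spec phi1 in RP.
have phi1C c : phi1 c%:MP = ratfunC K (1 + n) c by rewrite /= mpoly_shiftC.
have Rground a : R (ratfunC K n a) (ratfunC K (1 + n) a).
  by rewrite -phi1C; apply: poly_spec_tofrac.
have Ract g : g \in G -> forall x y, R x y ->
    R (ratfun_act rW (coset H g) x) (ratfun_act rV g y).
  move=> Gg; apply: (poly_spec_act actV phi1C _ Gg) => [|i].
    exact: mem_quotient.
  by rewrite /= mpoly_shiftX ratfun_act_tofrac // twisted_act_shift.
have totR : spec_total R (fun _ => True).
  move=> x _; have [a [b [nzb ->]]] := ratfunP x.
  exists (phi1 a / phi1 b), a, b; split=> //.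
  rewrite /= tofrac_eq0; apply: contraNneq nzb => b0.
  by rewrite -(mpoly_shiftK b) b0 rmorph0.
have sfS := residue_subfield RP sfE.
set S := residue R E in sfS.
have KS : subpred_of (ground_field (ratfunC K (1 + n))) S.
  by move=> _ [a ->]; exists (ratfunC K n a); split=> //; apply: KE; exists a.
have sfSx := @fadjoin_subfield _ S [:: x0].
have Sx_x0 : fadjoin S [:: x0] x0 by apply: fadjoin_mem; rewrite mem_head.
exists (fadjoin S [:: x0]); split=> //.
- by move=> x /KS; apply: fadjoin_base.
- move=> g Gg; apply: fadjoin_min; first exact: (act_preim_subfield actV Gg sfSx).
    move=> y [x [Ex Rxy]]; apply: fadjoin_base.
    exists (ratfun_act rW (coset H g) x); split; last exact: Ract.
    by apply: stE; rewrite ?mem_quotient.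
  move=> y; rewrite inE => /eqP->; rewrite ratfun_act_x0 //.
  apply: (subfieldM sfSx) => //.
  by apply: fadjoin_base; apply: KS; exists (chi g^-1%g).
- move=> g Gg fix_g.
  have chig : chi g = 1.
    have /eqP := fix_g _ Sx_x0; rewrite ratfun_act_x0 //.
    rewrite -subr_eq0 -{2}[x0]mul1r -mulrBl mulf_eq0.
    rewrite (negPf ratfun_neq0_x0) orbF.
    rewrite -(rmorph1 (ratfunC K (1 + n))) subr_eq0 => /eqP/fmorph_inj chi1'.
    have := chiM Gg (groupVr Gg); rewrite mulgV (chi1 chi_neq0 chiM) chi1'.
    by rewrite mulr1.
  apply: chiH => //; apply: coset_idr; first exact: (subsetP nHG).
  apply: faithE; first exact: mem_quotient.
  move=> x Ex; have [y Rxy] := totR x I.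
  apply/eqP; rewrite -subr_eq0; apply/eqP.
  apply: (spec_total_inj RP (F := fun _ => True)) => //.
  rewrite -(subrr y); apply: (specB RP) => //.
  rewrite -[X in R _ X](fix_g y); first exact: Ract.
  by apply: fadjoin_base; exists x.
- have sfK := ground_field_subfield (ratfunC K (1 + n)).
  have trS : trdeg_le (ground_field (ratfunC K (1 + n))) S d.
    apply: (residue_trdeg_le RP _ _ _ trE).
    + exact: ground_field_subfield.
    + exact: ground_field_total Rground.
    + exact: residue_ground_field RP Rground.
  have [s [_ _ le_s alg_s]] := trdeg_le_basis sfK trS.
  move=> t Et free_t; apply: leq_trans (_ : size (x0 :: s) <= _)%N; last first.
    by rewrite /= ltnS.
  apply: trdeg_le_spanning Et free_t => // x; move: x.
  have sfKs := @fadjoin_subfield _ (ground_field (ratfunC K (1 + n))) (x0 :: s).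
  apply: fadjoin_min; first exact: algebraic_over_subfield.
    move=> y /alg_s; apply: algebraic_over_sub; apply: fadjoin_sub.
      by move=> z; apply: fadjoin_base.
    by move=> z sz; apply: fadjoin_mem; rewrite inE sz orbT.
  move=> y; rewrite inE => /eqP->; apply: algebraic_over_base; first exact: sfKs.
  by apply: fadjoin_mem; exact: mem_head.
Qed.

Let phi2 : {rmorphism {mpoly K[1 + n]} -> KW} :=
  (tofracW : {rmorphism _ -> _}) \o @mpoly_at0 K n.

(** The valuation of K(W)(x0) at x0 = 0. *)
Lemma discrete_x0 : discrete (poly_spec phi2) x0.
Proof.
have RP := poly_spec_specialization phi2.
have unitP p : mpoly_at0 p != 0 -> spec_unit (poly_spec phi2) (tofracV p).
  move=> nzp; exists (phi2 p); first exact: poly_spec_tofrac.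
  by rewrite /= tofrac_eq0.
split; first exact: ratfun_neq0_x0.
  have <- : phi2 'X_(lshift n (0 : 'I_1)) = 0 by rewrite /= mpoly_at0X0 tofrac0.
  exact: poly_spec_tofrac.
move=> f nzf; have [a [b [nzb def_f]]] := ratfunP f.
have nza : a != 0.
  by apply: contraNneq nzf => a0; rewrite def_f a0 tofrac0 mul0r.
have [i [p [def_a nzp]]] := mpoly_first_order nza.
have [j [q [def_b nzq]]] := mpoly_first_order nzb.
exists (i%:Z - j%:Z), (tofracV p / tofracV q); split; last first.
  apply: spec_unitM => //; first exact: unitP.
  by apply: spec_unitV => //; apply: unitP.
rewrite def_f def_a def_b !tofracM !tofracXn -mulf_div.
by rewrite (expfzDr _ _ ratfun_neq0_x0) -exprnN.
Qed.

(** H acts trivially on the residues at x0 = 0 of a compression E. The kernel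
    of this action is cyclic, generated by a central element whose order is
    that of a root of unity in K, so by assumption it is no larger than H, and
    G / H is faithful on the residues. *)
Lemma compressible_twisted_quotient (sigma : gT) d :
    no_wild_subgroup K G -> sigma \in H -> H \subset G -> sigma != 1%g ->
    (forall tau, tau \in 'Z(G)%g -> H \proper <[tau]>%g ->
       ~ exists z : K, #[tau]%g.-primitive_root z) ->
    compressible (ratfunC K (1 + n)) G (ratfun_act rV) d ->
  exists2 d', d = d'.+1 &
    compressible (ratfunC K n) (G / H)%G (ratfun_act rW) d'.
Proof.
move=> no_wild Hsigma sHG nt_sigma no_root [E [sfE KE stE faithE trE]].
have RP := poly_spec_specialization phi2; set R := poly_spec phi2 in RP.
have phi2C c : phi2 c%:MP = ratfunC K n c by rewrite /= mpoly_at0C.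
have Rground a : R (ratfunC K (1 + n) a) (ratfunC K n a).
  by rewrite -phi2C; apply: poly_spec_tofrac.
pose act' g := ratfun_act rW (coset H g).
have Ract g : g \in G -> forall x y, R x y -> R (ratfun_act rV g x) (act' g y).
  move=> Gg; apply: (poly_spec_act actW phi2C Gg) => [|i].
    exact: mem_quotient.
  case: (split_ordP i) => j ->.
    rewrite [j]ord1 twisted_act_first -mul_mpolyC rmorphM /=.
    rewrite mpoly_at0X0 tofrac0 mulr0.
    by rewrite (actE actW (mem_quotient H Gg)) rmorph0.
  rewrite twisted_act_shift //= mpoly_shiftK mpoly_at0X ratfun_act_tofrac //.
  exact: mem_quotient.
have kerH g : g \in H -> residue_kernel G (ratfun_act rV) R E g.
  move=> Hg; split=> [|x y _ Rxy]; first exact: (subsetP sHG).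
  have := Ract g (subsetP sHG _ Hg) x y Rxy.
  by rewrite /act' coset_id // (field_act_id actW).
have ex_x : exists x, [/\ E x, x != 0 & R x 0].
  have [Gsigma ksigma] := kerH _ Hsigma.
  exact: (exists_uniformizer actV RP sfE stE faithE discrete_x0 Gsigma
    nt_sigma ksigma).
have unit_act g : g \in G -> spec_unit R (ratfun_act rV g x0 / x0).
  move=> Gg; rewrite ratfun_act_x0 // mulfK ?ratfun_neq0_x0 //.
  exists (ratfunC K n (chi g^-1%g)) => //.
  by rewrite fmorph_eq0 chi_neq0 ?groupV.
have [t [Zt kerP root_t]] := residue_kernel_cyclic actV RP Rground Ract sfE
  stE faithE no_wild discrete_x0 unit_act (@ratfun_root_of_unity K n) ex_x.
have defH : H :=: <[t]>%g.
  have sHt : H \subset <[t]>%g by apply/subsetP => g /kerH/kerP.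
  apply/eqP; rewrite eqEproper sHt; apply/negP => prHt.
  exact: no_root prHt root_t.
have [x [Ex nzx Rx0]] := ex_x.
have sfK := ground_field_subfield (ratfunC K (1 + n)).
have [d' -> trE'] := residue_trdeg_lt RP sfK (ground_field_total Rground)
  (residue_ground_field RP Rground) trE Ex nzx Rx0.
exists d' => //.
apply: (residue_compressible (f := coset H) RP Rground _ Ract sfE KE stE) => //.
  by move=> _ /morphimP[g Ng Gg ->]; exists g.
move=> g Gg fix_g; apply: coset_id; rewrite defH; apply/kerP.
split=> // y z Ey Ryz; rewrite -[z](fix_g y z) //; exact: Ract.
Qed.

End TwistedCompression.

(** * Essential dimension of groups *)

Lemma ratfun_compressible (K : fieldType) (gT : finGroupType) (G : {group gT})
    n (rG : mx_representation K G n) : mx_faithful rG ->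
  compressible (ratfunC K n) G (ratfun_act rG) n.
Proof.
move=> faithG; exists (fun _ => True); split=> //; first exact: ratfun_act_faithful.
pose t i : ratfun K n := @FracField.tofrac {mpoly K[n]} 'X_i.
have sfK := ground_field_subfield (ratfunC K n).
have le_n := @trdeg_le_spanning _ _ (fun _ => True) (codom t) sfK.
rewrite size_codom card_ord in le_n; apply: le_n => f _.
have sft := @fadjoin_subfield _ (ground_field (ratfunC K n)) (codom t).
apply: (algebraic_over_base sft).
have tofrac_t (a : {mpoly K[n]}) :
    fadjoin (ground_field (ratfunC K n)) (codom t) (FracField.tofrac a).
  have -> : FracField.tofrac a = mmap (ratfunC K n) t a.
    move: a; apply: (@mpoly_rmorph_eq K _ n (@FracField.tofrac {mpoly K[n]})
      (mmap (ratfunC K n) t)) => [c|i] /=; first by rewrite mmapC.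
    by rewrite mmapX mmap1U.
  by apply: mmap_fadjoin => i; apply: codom_f.
have [a [b [_ ->]]] := ratfunP f.
by apply: (subfieldM sft) => //; apply: (subfieldV sft).
Qed.

(** One faithful representation determines the essential dimension. *)
Lemma ed_group_compressible (K : fieldType) (gT : finGroupType) (G : {group gT})
    n (rG : mx_representation K G n) d : mx_faithful rG ->
    compressible (ratfunC K n) G (ratfun_act rG) d ->
    (forall e, compressible (ratfunC K n) G (ratfun_act rG) e -> (d <= e)%N) ->
  ed_group_is K G d.
Proof.
move=> faithG comp_d min_d m rG' faithG'.
apply: ed_ext_is_compressible.
- exact: ratfun_field_action.
- exact: ratfun_act_faithful.
- exact: compressible_change_rep comp_d.
- move=> e comp_e; apply: min_d; exact: compressible_change_rep comp_e.
Qed.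

Theorem theorem4p5 (p : nat) (gT : finGroupType) (G : {group gT})
  (K : fieldType) (sigma : gT)
  (p_prime : prime p)
  (hyp_char : [pchar K]%R =i pred0 \/
     exists l : nat, l \in [pchar K]%R /\
       forall H : {group gT}, (H <| G)%g -> (l.-group H)%g -> (H :=: 1)%g)
  (sigma_central : sigma \in ('Z(G))%g)
  (sigma_order : #[sigma]%g = p)
  (hyp_character : exists chi : gT -> K,
     (forall x, x \in G -> chi x <> 0%R) /\
     (forall x y, x \in G -> y \in G -> chi (x * y)%g = (chi x * chi y)%R) /\
     chi sigma <> 1%R)
  (hyp_roots : forall tau : gT, tau \in ('Z(G))%g ->
     (<[sigma]> \proper <[tau]>)%g ->
     ~ exists z : K, (#[tau]%g).-primitive_root%R z) :
  exists d : nat,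
    ed_group_is K (G / <[sigma]>)%G d /\ ed_group_is K G (d + 1).
Proof.
have /centerP[Gsigma cGsigma] := sigma_central.
have [chi [chi_neq0' [chiM chi_sigma]]] := hyp_character.
have chi_neq0 x : x \in G -> chi x != 0 by move/chi_neq0'/eqP.
pose H := <[sigma]>%G; have sHG : H \subset G by rewrite cycle_subG.
have nHG : G \subset 'N(H)%g.
  apply: subset_trans (cent_sub _); rewrite cent_cycle.
  by apply/subsetP => g Gg; apply/cent1P/commute_sym/cGsigma.
have chiX i : chi (sigma ^+ i)%g = chi sigma ^+ i.
  elim: i => [|i IHi]; first by rewrite expg0 (chi1 chi_neq0 chiM).
  by rewrite expgS chiM ?groupX // IHi exprS.
have chiH x : x \in H -> x \in G -> chi x = 1 -> x = 1%g.
  move=> /cycleP[i ->] _; rewrite chiX => chi_i.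
  have chi_p : chi sigma ^+ p = 1.
    by rewrite -sigma_order -chiX expg_order (chi1 chi_neq0 chiM).
  have [m prim_m dvd_mp] := prim_order_exists (prime_gt0 p_prime) chi_p.
  have m_neq1 : m != 1%N.
    by apply: contra_not_neq chi_sigma => m1; rewrite -(prim_expr_order prim_m) m1.
  move/(prime_nt_dvdP p_prime m_neq1): dvd_mp prim_m => -> prim_p.
  by apply/eqP; rewrite -order_dvdn sigma_order (prim_order_dvd prim_p) chi_i.
have nt_sigma : sigma != 1%g.
  by rewrite -order_gt1 sigma_order prime_gt1.
pose rW := regular_repr K (G / H)%G.
have faithW : mx_faithful rW by apply: regular_mx_faithful.
pose rV := twisted_repr rW nHG chi_neq0 chiM.
have faithV : mx_faithful rV by apply: twisted_repr_faithful.
have [|d [comp_d min_d]] := @nat_least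
    (compressible (ratfunC K _) (G / H)%G (ratfun_act rW)).
  by exists #|(G / H)%G|; apply: ratfun_compressible.
exists d; split; first exact: ed_group_compressible comp_d min_d.
rewrite addn1; apply: ed_group_compressible faithV _ _.
  exact: compressible_twisted.
move=> e comp_e.
have [e' -> comp_e'] := compressible_twisted_quotient hyp_char
  (cycle_id sigma) sHG nt_sigma hyp_roots comp_e.
exact: min_d.
Qed.
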